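(* Let $\mathcal{S}$ be the set of pairs $(w,h)$ with $h>0$ and $w\in C^{2,\alpha}_{2\pi}(\mathbb{R})$, $[w]=0$. For $(w,h)\in\mathcal{S}$ put $v=w+h$ and $$\Lambda(w,h)=\int_{-\pi}^{\pi}\Big(Qv-gv^2-\frac{\Upsilon^2}{3}v^3\Big)\Big(\frac1k+\mathcal{C}_{kh}(v')\Big)dx+\int_{-\pi}^{\pi}\Big(m-\frac{\Upsilon}{2}v^2\Big)\Big(\frac{m}{kh}-\frac{\Upsilon}{2kh}[v^2]-\Upsilon\,\mathcal{C}_{kh}(vv')\Big)dx.$$ Then any critical point $(w,h)$ of $\Lambda$ in the space $\mathcal{S}$ satisfies, with $v=w+h$, the equation $$\mathcal{C}_{kh}\big((Q-2gv-\Upsilon^2v^2)v'\big)+(Q-2gv-\Upsilon^2v^2)\Big(\frac1k+\mathcal{C}_{kh}(v')\Big)-2\Upsilon v\Big(\frac{m}{kh}-\frac{\Upsilon}{2kh}[v^2]-\Upsilon\,\mathcal{C}_{kh}(vv')\Big)-\frac{Q-2\Upsilon m-2gh}{k}+2g\,[v\,\mathcal{C}_{kh}(v')]=0\quad\text{on }\mathbb{R},$$ as well as the scalar constraint $$\Big[\Big\{\frac{m}{kh}-\frac{\Upsilon}{2kh}[v^2]-\Upsilon\,\mathcal{C}_{kh}(vv')+\Upsilon v\Big(\frac1k+\mathcal{C}_{kh}(v')\Big)\Big\}^2\Big]-\Big[(Q-2gv)\Big\{(v')^2+\Big(\frac1k+\mathcal{C}_{kh}(v')\Big)^2\Big\}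\Big]=0.$$
   Context: Fixed constants: $g>0$, $k>0$, $\Upsilon,m,Q\in\mathbb{R}$, $\alpha\in(0,1)$. $C^{2,\alpha}_{2\pi}(\mathbb{R})$ is the space of $2\pi$-periodic real functions of class $C^{2,\alpha}$. For a $2\pi$-periodic function $f$, $[f]=\frac1{2\pi}\int_{-\pi}^{\pi}f\,dx$. For $d>0$, $\mathcal{C}_d$ acts on $2\pi$-periodic functions of zero mean by $$w=\sum_{n\ge1}\big(a_n\cos(nx)+b_n\sin(nx)\big)\ \mapsto\ \mathcal{C}_d(w)=\sum_{n\ge1}\coth(nd)\big(a_n\sin(nx)-b_n\cos(nx)\big).$$ A critical point of $\Lambda$ in $\mathcal{S}$ is a pair $(w,h)\in\mathcal{S}$ such that $\lim_{\varepsilon\to0}\varepsilon^{-1}\big(\Lambda(w+\varepsilon\varphi,h)-\Lambda(w,h)\big)=0$ for every smooth $2\pi$-periodic $\varphi$ with $[\varphi]=0$, and such that the derivative of $\Lambda(w,h)$ with respect to $h$ (with $w$ fixed, and $v=w+h$) vanishes. *)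

(* Defs.v *)
(* Stdlib reals, with Coquelicot's total operators for analysis. *)
From Stdlib Require Import Reals.
From Coquelicot Require Import Coquelicot.
Open Scope R_scope.

Definition periodic (f : R -> R) : Prop :=
  forall x : R, f (x + 2 * PI) = f x.

Definition mean (f : R -> R) : R := / (2 * PI) * RInt f (- PI) PI.

(* 2 pi-periodic of class C^{2,alpha}.  The case x = y is excluded because
   [Rpower 0 alpha] is not 0; continuity of the second derivative follows from
   the Hoelder bound. *)
Definition C2_periodic (alpha : R) (f : R -> R) : Prop :=
  periodic f /\
  (forall (n : nat) (x : R), (n <= 2)%nat -> ex_derive_n f n x) /\
  (exists M : R, forall x y : R, x <> y ->
     Rabs (Derive_n f 2 x - Derive_n f 2 y) <= M * Rpower (Rabs (x - y)) alpha).

Definition smooth_periodic (f : R -> R) : Prop :=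
  periodic f /\ forall (n : nat) (x : R), ex_derive_n f n x.

Definition coth (x : R) : R := cosh x / sinh x.

Definition fourier_cos (f : R -> R) (n : nat) : R :=
  / PI * RInt (fun x => f x * cos (INR n * x)) (- PI) PI.

Definition fourier_sin (f : R -> R) (n : nat) : R :=
  / PI * RInt (fun x => f x * sin (INR n * x)) (- PI) PI.

(* The operator C_d, as the pointwise sum of its Fourier series, which starts
   at n = 1, whence the index [S n].  It is meant for zero-mean periodic f and
   is only applied below to f of class C^{1,alpha}, whose Fourier series, like
   the one below, converges absolutely and uniformly. *)
Definition Cop (d : R) (f : R -> R) (x : R) : R :=
  Series (fun n : nat =>
    coth (INR (S n) * d) *
    (fourier_cos f (S n) * sin (INR (S n) * x)
     - fourier_sin f (S n) * cos (INR (S n) * x))).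

Definition Lambda (g k Upsilon m Q : R) (w : R -> R) (h : R) : R :=
  let v := fun x => w x + h in
  let v' := Derive v in
  RInt (fun x =>
    (Q * v x - g * v x ^ 2 - Upsilon ^ 2 / 3 * v x ^ 3)
    * (1 / k + Cop (k * h) v' x)) (- PI) PI
  + RInt (fun x =>
    (m - Upsilon / 2 * v x ^ 2)
    * (m / (k * h) - Upsilon / (2 * k * h) * mean (fun y => v y ^ 2)
       - Upsilon * Cop (k * h) (fun y => v y * v' y) x)) (- PI) PI.

Definition in_S (alpha : R) (w : R -> R) (h : R) : Prop :=
  0 < h /\ C2_periodic alpha w /\ mean w = 0.

(* [is_lim _ 0 _] is the limit along eps <> 0.  The shift v = w + t is part of
   [Lambda], so the last clause differentiates in h with w held fixed. *)
Definition critical_point (g k Upsilon m Q alpha : R) (w : R -> R) (h : R)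
    : Prop :=
  in_S alpha w h /\
  (forall phi : R -> R, smooth_periodic phi -> mean phi = 0 ->
     is_lim (fun eps : R =>
       / eps * (Lambda g k Upsilon m Q (fun x => w x + eps * phi x) h
                - Lambda g k Upsilon m Q w h)) 0 0) /\
  is_derive (fun t : R => Lambda g k Upsilon m Q w t) h 0.

(* Main.v *)
Require Import Defs.
From Stdlib Require Import Reals Lra Lia FunctionalExtensionality.
From Coquelicot Require Import Coquelicot.
Open Scope R_scope.

(** Everything is read off from Fourier coefficients.  Put d = k h and let D(f, u) be
    the integral over a period of f times C_d(u').  With a_n, b_n and a'_n, b'_n the
    Fourier coefficients of f and u, this is

      D(f, u) = PI * sum over n of n coth(n d) (a_n a'_n + b_n b'_n),

    a symmetric bilinear form ([energy_sym]); for f and u of zero mean it is the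
    Dirichlet form of the strip of height d on harmonic functions that equal f and u on
    top and vanish on the bottom.  Writing v v' = (v^2)' / 2 turns
    Lambda into a polynomial in v built from means, D(F(v), v) and D(v^2, v^2), where
    F(v) = Q v - g v^2 - Upsilon^2 v^3 / 3 ([Lambda_reduced]).

    The equation.  Bilinearity makes Lambda(v + eps phi) a polynomial in eps, and
    symmetry moves C_d off phi, so the coefficient of eps is the integral of phi times
    a continuous function E of x ([variation_euler]).  Taking for phi the functions
    cos(n x) and sin(n x), n >= 1, shows that every nonconstant Fourier mode of E
    vanishes, whence E is constant since the trigonometric system is complete
    ([trig_complete]).  Its mean is computed by pairing E with 1; the terms in
    Upsilon^2 cancel because D(v, v^2) = D(v^2, v) ([integral_euler]).

    The constraint.  The height h enters both through v = w + h and through d = k h.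
    The first dependence contributes the variation in the direction phi = 1, that is,
    the integral of E.  For the second, coth' = 1 - coth^2 and Parseval's identity give

      dD(f, u)/dd = integral of f' u' - integral of C_d(f') C_d(u')

    ([is_derive_energy]), which is Hadamard's formula for the Dirichlet energy combined
    with the fact that the integral of V_x U_x - V_y U_y over a horizontal line is the
    same at every height when V and U are harmonic.  In the resulting identity the
    equation E = const expresses C_d(F(v)') through v, C_d(v') and C_d(v v'); the
    constant drops out and what remains is the constraint ([critical_constraint]). *)

(** * Continuous functions and integrals over a period *)

Definition cont (f : R -> R) : Prop := forall x : R, continuous f x.

Lemma cont_const (c : R) : cont (fun _ => c).
Proof. intro x. apply continuous_const. Qed.

Lemma cont_id : cont (fun x => x).
Proof. intro x. apply continuous_id. Qed.

Lemma cont_plus (f g : R -> R) : cont f -> cont g -> cont (fun x => f x + g x).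
Proof. intros Hf Hg x. now apply (continuous_plus f g). Qed.

Lemma cont_minus (f g : R -> R) : cont f -> cont g -> cont (fun x => f x - g x).
Proof. intros Hf Hg x. now apply (continuous_minus f g). Qed.

Lemma cont_opp (f : R -> R) : cont f -> cont (fun x => - f x).
Proof. intros Hf x. now apply (continuous_opp f). Qed.

Lemma cont_mult (f g : R -> R) : cont f -> cont g -> cont (fun x => f x * g x).
Proof. intros Hf Hg x. now apply (continuous_mult f g). Qed.

Lemma cont_pow (f : R -> R) (n : nat) : cont f -> cont (fun x => f x ^ n).
Proof.
  intro Hf. induction n as [|n IH]; simpl.
  - apply cont_const.
  - now apply cont_mult.
Qed.

Lemma cont_abs (f : R -> R) : cont f -> cont (fun x => Rabs (f x)).
Proof.
  intros Hf x. apply (continuous_comp f Rabs); [apply Hf|].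
  apply (continuous_Rabs (f x)).
Qed.

Lemma derivable_cont (f : R -> R) : (forall x, ex_derive f x) -> cont f.
Proof. intros H x. now apply (ex_derive_continuous f). Qed.

Create HintDb cont.
#[local] Hint Resolve cont_const cont_id cont_plus cont_minus cont_opp cont_mult
  cont_pow cont_abs : cont.

Lemma cont_ex_RInt (f : R -> R) (a b : R) : cont f -> ex_RInt f a b.
Proof. intro H. apply (@ex_RInt_continuous R_CompleteNormedModule). auto. Qed.

Definition integral (f : R -> R) : R := RInt f (- PI) PI.

Lemma integral_ext (f g : R -> R) :
  (forall x, f x = g x) -> integral f = integral g.
Proof. intro H. apply RInt_ext. auto. Qed.

Lemma integral_plus (f g : R -> R) : cont f -> cont g ->
  integral (fun x => f x + g x) = integral f + integral g.
Proof. intros. apply (RInt_plus f g); now apply cont_ex_RInt. Qed.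

Lemma integral_minus (f g : R -> R) : cont f -> cont g ->
  integral (fun x => f x - g x) = integral f - integral g.
Proof. intros. apply (RInt_minus f g); now apply cont_ex_RInt. Qed.

Lemma integral_scal (c : R) (f : R -> R) : cont f ->
  integral (fun x => c * f x) = c * integral f.
Proof. intros. apply (RInt_scal f); now apply cont_ex_RInt. Qed.

Lemma integral_const (c : R) : integral (fun _ => c) = 2 * PI * c.
Proof.
  unfold integral. rewrite RInt_const. unfold scal; simpl. unfold mult; simpl. ring.
Qed.

Lemma mean_integral (f : R -> R) : mean f = / (2 * PI) * integral f.
Proof. reflexivity. Qed.

Lemma integral_mean (f : R -> R) : integral f = 2 * PI * mean f.
Proof. rewrite mean_integral. field. apply PI_neq0. Qed.

(** * Trigonometric functions and Fourier coefficients *)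

(** Cosines and sines are indexed by a boolean, so that differentiation is [negb] on
    the index and each fact on coefficients is stated once. *)
Definition trig (b : bool) (n : nat) (x : R) : R :=
  if b then cos (INR n * x) else sin (INR n * x).

Definition coef (b : bool) (f : R -> R) (n : nat) : R :=
  / PI * integral (fun x => f x * trig b n x).

Definition deriv_sign (b : bool) : R := if b then -1 else 1.

Lemma is_derive_trig (b : bool) (n : nat) (x : R) :
  is_derive (trig b n) x (deriv_sign b * INR n * trig (negb b) n x).
Proof. destruct b; unfold trig, deriv_sign; simpl; auto_derive; trivial; ring. Qed.

Lemma cont_trig (b : bool) (n : nat) : cont (trig b n).
Proof. apply derivable_cont. intro x. eexists. apply is_derive_trig. Qed.
#[local] Hint Resolve cont_trig : cont.

Lemma cos_sin_shift (n : nat) (x : R) :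
  cos (INR n * (x + 2 * PI)) = cos (INR n * x)
  /\ sin (INR n * (x + 2 * PI)) = sin (INR n * x).
Proof.
  replace (INR n * (x + 2 * PI)) with (INR n * x + 2 * INR n * PI) by ring.
  split; [apply cos_period | apply sin_period].
Qed.

Lemma periodic_trig (b : bool) (n : nat) : periodic (trig b n).
Proof. intro x. destruct b; apply cos_sin_shift. Qed.

Lemma trig_bound (b : bool) (n : nat) (x : R) : Rabs (trig b n x) <= 1.
Proof.
  apply Rabs_le. destruct b; [apply COS_bound | apply SIN_bound].
Qed.

Lemma sin_INR_PI (n : nat) : sin (INR n * PI) = 0.
Proof. apply sin_eq_0_1. exists (Z.of_nat n). now rewrite INR_IZR_INZ. Qed.

Lemma integral_cos (a : R) : a <> 0 -> sin (a * PI) = 0 ->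
  integral (fun x => cos (a * x)) = 0.
Proof.
  intros Ha Hs. apply is_RInt_unique.
  replace 0 with (minus (sin (a * PI) / a) (sin (a * - PI) / a)).
  - apply (is_RInt_derive (fun x => sin (a * x) / a)).
    + intros. auto_derive; trivial. field. trivial.
    + intros. apply (derivable_cont (fun x => cos (a * x))).
      intro. auto_derive. trivial.
  - replace (a * - PI) with (- (a * PI)) by ring. rewrite sin_neg, Hs.
    unfold minus, plus, opp; simpl. field. trivial.
Qed.

Lemma integral_sin (a : R) : integral (fun x => sin (a * x)) = 0.
Proof.
  destruct (Req_dec a 0) as [->|Ha].
  { rewrite (integral_ext _ (fun _ => 0)).
    - rewrite integral_const. ring.
    - intro x. now rewrite Rmult_0_l, sin_0. }
  apply is_RInt_unique.
  replace 0 with (minus (- cos (a * PI) / a) (- cos (a * - PI) / a)).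
  - apply (is_RInt_derive (fun x => - cos (a * x) / a)).
    + intros. auto_derive; trivial. field. trivial.
    + intros. apply (derivable_cont (fun x => sin (a * x))).
      intro. auto_derive. trivial.
  - replace (a * - PI) with (- (a * PI)) by ring. rewrite cos_neg.
    unfold minus, plus, opp; simpl. field. trivial.
Qed.

Lemma integral_trig (b : bool) (n : nat) : integral (trig b (S n)) = 0.
Proof.
  destruct b; [apply integral_cos | apply integral_sin].
  - apply not_0_INR. lia.
  - apply sin_INR_PI.
Qed.

(** The product-to-sum formulas leave cosines and sines of (n - m) x and (n + m) x,
    which integrate to zero except for the cosine at n = m. *)
Lemma trig_orthogonal (b c : bool) (n m : nat) :
  integral (fun x => trig b (S n) x * trig c (S m) x)
  = if Bool.eqb b c then (if Nat.eqb n m then PI else 0) else 0.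
Proof.
  assert (Hp : INR (S n) + INR (S m) <> 0).
  { rewrite <- plus_INR. apply not_0_INR. lia. }
  assert (Hsp : sin ((INR (S n) + INR (S m)) * PI) = 0)
    by (rewrite <- plus_INR; apply sin_INR_PI).
  assert (Hsm : sin ((INR (S n) - INR (S m)) * PI) = 0).
  { rewrite Rmult_minus_distr_r, sin_minus, !sin_INR_PI. ring. }
  assert (Cp := integral_cos _ Hp Hsp).
  assert (Cm : integral (fun x => cos ((INR (S n) - INR (S m)) * x))
               = if Nat.eqb n m then 2 * PI else 0).
  { destruct (Nat.eqb_spec n m) as [->|Hnm].
    - rewrite (integral_ext _ (fun _ => 1)).
      + rewrite integral_const. ring.
      + intro x. replace ((INR (S m) - INR (S m)) * x) with 0 by ring. apply cos_0.
    - apply integral_cos; trivial. intro E. apply Hnm.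
      apply Rminus_diag_uniq, INR_eq in E. now injection E. }
  assert (Hc : forall a, cont (fun x => cos (a * x)))
    by (intro a; apply derivable_cont; intro; auto_derive; trivial).
  assert (Hs : forall a, cont (fun x => sin (a * x)))
    by (intro a; apply derivable_cont; intro; auto_derive; trivial).
  set (p := INR (S n)) in *. set (q := INR (S m)) in *.
  destruct b, c; unfold trig; fold p q; simpl Bool.eqb.
  - rewrite (integral_ext _ (fun x => / 2 * (cos ((p - q) * x) + cos ((p + q) * x)))).
    + rewrite integral_scal, integral_plus, Cp, Cm by auto with cont.
      destruct (Nat.eqb n m); field.
    + intro x. rewrite Rmult_minus_distr_r, Rmult_plus_distr_r, cos_minus, cos_plus. field.
  - rewrite (integral_ext _ (fun x => / 2 * (sin ((p + q) * x) - sin ((p - q) * x)))).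
    + rewrite integral_scal, integral_minus, !integral_sin by auto with cont. ring.
    + intro x. rewrite Rmult_minus_distr_r, Rmult_plus_distr_r, sin_minus, sin_plus. field.
  - rewrite (integral_ext _ (fun x => / 2 * (sin ((p + q) * x) + sin ((p - q) * x)))).
    + rewrite integral_scal, integral_plus, !integral_sin by auto with cont. ring.
    + intro x. rewrite Rmult_minus_distr_r, Rmult_plus_distr_r, sin_minus, sin_plus. field.
  - rewrite (integral_ext _ (fun x => / 2 * (cos ((p - q) * x) - cos ((p + q) * x)))).
    + rewrite integral_scal, integral_minus, Cp, Cm by auto with cont.
      destruct (Nat.eqb n m); field.
    + intro x. rewrite Rmult_minus_distr_r, Rmult_plus_distr_r, cos_minus, cos_plus. field.
Qed.

(** * Bessel's inequality and absolutely summable coefficients *)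

(** [sum_Sn] with the addition of [R] in place of that of the abelian monoid, so that
    [ring] and [lra] see it. *)
Lemma sum_n_S (a : nat -> R) (n : nat) : sum_n a (S n) = sum_n a n + a (S n).
Proof. exact (sum_Sn a n). Qed.

Lemma integral_ge_0 (f : R -> R) : cont f -> (forall x, 0 <= f x) -> 0 <= integral f.
Proof.
  intros Hf H. apply RInt_ge_0; auto using cont_ex_RInt.
  generalize PI_RGT_0; lra.
Qed.

Lemma coef_ext (b : bool) (f g : R -> R) (n : nat) :
  (forall x, f x = g x) -> coef b f n = coef b g n.
Proof.
  intro H. unfold coef. f_equal. apply integral_ext. intro x. now rewrite H.
Qed.

Lemma coef_minus (b : bool) (f g : R -> R) (n : nat) : cont f -> cont g ->
  coef b (fun x => f x - g x) n = coef b f n - coef b g n.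
Proof.
  intros Hf Hg. unfold coef.
  rewrite (integral_ext _ (fun x => f x * trig b n x - g x * trig b n x))
    by (intro; ring).
  rewrite integral_minus by auto with cont. ring.
Qed.

Lemma coef_scal (b : bool) (c : R) (f : R -> R) (n : nat) : cont f ->
  coef b (fun x => c * f x) n = c * coef b f n.
Proof.
  intros Hf. unfold coef.
  rewrite (integral_ext _ (fun x => c * (f x * trig b n x))) by (intro; ring).
  rewrite integral_scal by auto with cont. ring.
Qed.

Lemma coef_trig (b c : bool) (n m : nat) :
  coef b (trig c (S m)) (S n) = if Bool.eqb b c then (if Nat.eqb n m then 1 else 0) else 0.
Proof.
  unfold coef. rewrite trig_orthogonal, (Nat.eqb_sym m n).
  replace (Bool.eqb c b) with (Bool.eqb b c) by (destruct b, c; reflexivity).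
  destruct (Bool.eqb b c), (Nat.eqb n m); field; apply PI_neq0.
Qed.

Definition harmonic (f : R -> R) (n : nat) (x : R) : R :=
  coef true f (S n) * trig true (S n) x + coef false f (S n) * trig false (S n) x.

Lemma cont_harmonic (f : R -> R) (n : nat) : cont (harmonic f n).
Proof. unfold harmonic. auto 7 with cont. Qed.
#[local] Hint Resolve cont_harmonic : cont.

Lemma coef_harmonic (b : bool) (f : R -> R) (n m : nat) :
  coef b (harmonic f m) (S n) = if Nat.eqb n m then coef b f (S n) else 0.
Proof.
  unfold harmonic.
  rewrite (coef_ext _ _ (fun x => coef true f (S m) * trig true (S m) x
     - (- coef false f (S m)) * trig false (S m) x)) by (intro; ring).
  rewrite coef_minus, !coef_scal, !coef_trig by auto with cont.
  destruct (Nat.eqb_spec n m) as [->|_]; destruct b; simpl; ring.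
Qed.

Definition spectral_energy (f : R -> R) (n : nat) : R :=
  coef true f (S n) ^ 2 + coef false f (S n) ^ 2.

Lemma integral_coef (b : bool) (f : R -> R) (n : nat) :
  integral (fun x => f x * trig b n x) = PI * coef b f n.
Proof. unfold coef. field. apply PI_neq0. Qed.

Lemma integral_mult_harmonic (f u : R -> R) (n : nat) : cont f ->
  integral (fun x => f x * harmonic u n x)
  = PI * (coef true u (S n) * coef true f (S n)
          + coef false u (S n) * coef false f (S n)).
Proof.
  intro Hf. unfold harmonic.
  rewrite (integral_ext _ (fun x =>
     coef true u (S n) * (f x * trig true (S n) x)
     + coef false u (S n) * (f x * trig false (S n) x))) by (intro; ring).
  rewrite integral_plus, !integral_scal, !integral_coef by auto with cont. ring.
Qed.

(** Pythagoras: [harmonic f n] is the orthogonal projection of [f] to the n-th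
    Fourier mode. *)
Lemma integral_sqr_minus_harmonic (f : R -> R) (n : nat) : cont f ->
  integral (fun x => (f x - harmonic f n x) ^ 2)
  = integral (fun x => f x ^ 2) - PI * spectral_energy f n.
Proof.
  intro Hf.
  rewrite (integral_ext _ (fun x => f x ^ 2 - 2 * (f x * harmonic f n x)
     + harmonic f n x * harmonic f n x)) by (intro; ring).
  rewrite integral_plus, integral_minus, integral_scal by auto 6 with cont.
  rewrite !integral_mult_harmonic, !coef_harmonic, Nat.eqb_refl by auto with cont.
  unfold spectral_energy. ring.
Qed.

(** Induction over [f]: subtracting the last mode lowers the integral of the square by
    its share and leaves the other coefficients unchanged. *)
Lemma bessel (N : nat) : forall f, cont f ->
  PI * sum_n (spectral_energy f) N <= integral (fun x => f x ^ 2).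
Proof.
  induction N as [|N IH]; intros f Hf.
  - rewrite sum_O.
    assert (H := integral_sqr_minus_harmonic f 0 Hf).
    assert (0 <= integral (fun x => (f x - harmonic f 0 x) ^ 2)).
    { apply integral_ge_0. auto with cont. intro; apply pow2_ge_0. }
    lra.
  - rewrite sum_n_S.
    assert (H := integral_sqr_minus_harmonic f (S N) Hf).
    specialize (IH (fun x => f x - harmonic f (S N) x) ltac:(auto with cont)).
    rewrite (sum_n_ext_loc _ (spectral_energy f)) in IH.
    2:{ intros n Hn. unfold spectral_energy.
        rewrite !coef_minus, !coef_harmonic by auto with cont.
        rewrite (proj2 (Nat.eqb_neq n (S N))) by lia.
        now rewrite !Rminus_0_r. }
    cbv beta in *. lra.
Qed.

Lemma ex_series_bounded (a : nat -> R) (M : R) :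
  (forall n, 0 <= a n) -> (forall n, sum_n a n <= M) -> ex_series a.
Proof.
  intros Ha HM. apply ex_finite_lim_seq_incr with M; trivial.
  intro n. change (sum_n a n <= sum_n a (S n)).
  rewrite sum_n_S. specialize (Ha (S n)). lra.
Qed.

Lemma spectral_energy_nonneg (f : R -> R) (n : nat) : 0 <= spectral_energy f n.
Proof.
  unfold spectral_energy.
  generalize (pow2_ge_0 (coef true f (S n))) (pow2_ge_0 (coef false f (S n))). lra.
Qed.

Lemma ex_series_spectral_energy (f : R -> R) : cont f -> ex_series (spectral_energy f).
Proof.
  intro Hf. apply ex_series_bounded with (integral (fun x => f x ^ 2) / PI).
  - apply spectral_energy_nonneg.
  - intro N. generalize (bessel N f Hf) PI_RGT_0. intros H HP.
    apply Rle_div_r; lra.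
Qed.

Lemma ex_series_dominated (a b : nat -> R) :
  (forall n, Rabs (a n) <= b n) -> ex_series b -> ex_series a.
Proof. intros H. now apply (ex_series_le a b). Qed.

Lemma ex_series_inv_sqr : ex_series (fun n => / INR (S n) ^ 2).
Proof.
  apply ex_series_bounded with 2.
  - intro n. left. apply Rinv_0_lt_compat, pow_lt, lt_0_INR. lia.
  - intro n. apply Rle_trans with (2 - / INR (S n)).
    + induction n as [|n IH].
      * rewrite sum_O. simpl. lra.
      * rewrite sum_n_S.
        assert (Hn : 0 < INR (S n)) by (apply lt_0_INR; lia).
        rewrite (S_INR (S n)). set (t := INR (S n)) in *.
        assert (/ (t + 1) ^ 2 <= / t - / (t + 1)).
        { replace (/ t - / (t + 1)) with (/ (t * (t + 1))) by (field; lra).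
          apply Rinv_le_contravar; nra. }
        lra.
    + assert (0 < / INR (S n)) by (apply Rinv_0_lt_compat, lt_0_INR; lia). lra.
Qed.

Definition periodic_C1 (f : R -> R) : Prop :=
  periodic f /\ (forall x, ex_derive f x) /\ cont (Derive f).

Lemma periodic_C1_cont f : periodic_C1 f -> cont f.
Proof. intros (_ & H & _). now apply derivable_cont. Qed.
#[local] Hint Resolve periodic_C1_cont : cont.
Lemma periodic_C1_cont_Derive f : periodic_C1 f -> cont (Derive f).
Proof. now intros (_ & _ & H). Qed.
#[local] Hint Resolve periodic_C1_cont_Derive : cont.

Lemma is_derive_product (f u : R -> R) (x : R) : ex_derive f x -> ex_derive u x ->
  is_derive (fun x => f x * u x) x (Derive f x * u x + f x * Derive u x).
Proof.
  intros Hf Hu. auto_derive; [auto|].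
  change (fun x => f x) with f. change (fun x => u x) with u. ring.
Qed.

(** Integration by parts; the boundary terms cancel by periodicity. *)
Lemma integral_Derive_mult (f u : R -> R) :
  periodic_C1 f -> periodic_C1 u ->
  integral (fun x => Derive f x * u x) = - integral (fun x => f x * Derive u x).
Proof.
  intros Hf Hu.
  assert (H : integral (fun x => Derive f x * u x + f x * Derive u x) = 0).
  { apply is_RInt_unique.
    replace 0 with (minus (f PI * u PI) (f (- PI) * u (- PI))).
    - apply (is_RInt_derive (fun x => f x * u x)).
      + intros x _. destruct Hf as (_ & Hf & _), Hu as (_ & Hu & _).
        now apply is_derive_product.
      + intros x _. apply (cont_plus (fun x => Derive f x * u x)); auto with cont.
    - destruct Hf as (Hf & _), Hu as (Hu & _).
      rewrite <- (Hf (- PI)), <- (Hu (- PI)). replace (- PI + 2 * PI) with PI by ring.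
      unfold minus, plus, opp; simpl. ring. }
  rewrite integral_plus in H by auto with cont. lra.
Qed.

Lemma Derive_trig b n : Derive (trig b n) = fun x => deriv_sign b * INR n * trig (negb b) n x.
Proof. apply functional_extensionality. intro x. apply is_derive_unique, is_derive_trig. Qed.

Lemma periodic_C1_trig b n : periodic_C1 (trig b n).
Proof.
  split; [apply periodic_trig|split].
  - intro x. eexists. apply is_derive_trig.
  - rewrite Derive_trig. auto with cont.
Qed.

Lemma coef_Derive (b : bool) (f : R -> R) (n : nat) : periodic_C1 f ->
  coef b (Derive f) n = - deriv_sign b * INR n * coef (negb b) f n.
Proof.
  intro Hf. unfold coef at 1.
  rewrite integral_Derive_mult, Derive_trig by auto using periodic_C1_trig.
  rewrite (integral_ext _ (fun x => deriv_sign b * INR n * (f x * trig (negb b) n x)))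
    by (intro; ring).
  rewrite integral_scal by auto with cont. unfold coef. field. apply PI_neq0.
Qed.

Definition summable (c : bool -> nat -> R) : Prop :=
  ex_series (fun n => Rabs (c true n) + Rabs (c false n)).

(** With t = n + 1, t times a coefficient of [f] is up to sign a coefficient of [f'], so
    2 |c| <= 1 / t^2 + (t c)^2, and Bessel's inequality for [f'] makes the right-hand
    side summable. *)
Lemma summable_coef (f : R -> R) : periodic_C1 f -> summable (fun b n => coef b f (S n)).
Proof.
  intro Hf. unfold summable.
  apply (ex_series_dominated _ (fun n => / INR (S n) ^ 2 + spectral_energy (Derive f) n)).
  2:{ apply (ex_series_plus (fun n => / INR (S n) ^ 2)).
      - apply ex_series_inv_sqr.
      - apply ex_series_spectral_energy. auto with cont. }
  intro n.
  assert (K : forall t c d, 0 < t -> d ^ 2 = (t * c) ^ 2 -> 2 * Rabs c <= / t ^ 2 + d ^ 2).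
  { intros t c d Ht ->.
    assert (0 <= (/ t - t * Rabs c) ^ 2) by apply pow2_ge_0.
    replace ((/ t - t * Rabs c) ^ 2) with (/ t ^ 2 - 2 * Rabs c + t ^ 2 * Rabs c ^ 2) in H
      by (field; lra).
    rewrite (pow2_abs c) in H. rewrite Rpow_mult_distr. lra. }
  assert (Hn : 0 < INR (S n)) by (apply lt_0_INR; lia).
  assert (K1 := K _ (coef true f (S n)) (coef false (Derive f) (S n)) Hn
     ltac:(rewrite coef_Derive by trivial; simpl deriv_sign; simpl negb; ring)).
  assert (K2 := K _ (coef false f (S n)) (coef true (Derive f) (S n)) Hn
     ltac:(rewrite coef_Derive by trivial; simpl deriv_sign; simpl negb; ring)).
  unfold spectral_energy.
  rewrite Rabs_right.
  - generalize (pow2_ge_0 (coef false (Derive f) (S n))) (pow2_ge_0 (coef true (Derive f) (S n))).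
    lra.
  - generalize (Rabs_pos (coef true f (S n))) (Rabs_pos (coef false f (S n))). lra.
Qed.

(** * Absolutely convergent trigonometric series *)

Definition trig_term (c : bool -> nat -> R) (x : R) (n : nat) : R :=
  c true n * trig true (S n) x + c false n * trig false (S n) x.

Definition trig_series (c : bool -> nat -> R) (x : R) : R := Series (trig_term c x).

Definition tail (c : bool -> nat -> R) (N : nat) : R :=
  Series (fun n => Rabs (c true n) + Rabs (c false n))
  - sum_n (fun n => Rabs (c true n) + Rabs (c false n)) N.

Lemma trig_term_bound c x n : Rabs (trig_term c x n) <= Rabs (c true n) + Rabs (c false n).
Proof.
  unfold trig_term. eapply Rle_trans; [apply Rabs_triang|].
  rewrite !Rabs_mult.
  generalize (trig_bound true (S n) x) (trig_bound false (S n) x)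
    (Rabs_pos (c true n)) (Rabs_pos (c false n)). nra.
Qed.

Lemma is_series_trig_term c x : summable c -> is_series (trig_term c x) (trig_series c x).
Proof.
  intro H. apply Series_correct. refine (ex_series_dominated _ _ _ H). apply trig_term_bound.
Qed.

Lemma series_minus_partial (a : nat -> R) (l : R) N : is_series a l ->
  is_series (fun n => a (S N + n)%nat) (l - sum_n a N).
Proof.
  intro H. apply (is_series_incr_n a (S N)); [lia|].
  match goal with |- is_series _ ?t => replace t with l; trivial end.
  change (l = l - sum_n a N + sum_n a N). ring.
Qed.

Lemma trig_series_tail c x N : summable c ->
  Rabs (trig_series c x - sum_n (trig_term c x) N) <= tail c N.
Proof.
  intro H.
  assert (H1 := series_minus_partial _ _ N (is_series_trig_term c x H)).
  assert (H2 := series_minus_partial _ _ N (Series_correct _ H)).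
  fold (tail c N) in H2.
  rewrite <- (is_series_unique _ _ H1), <- (is_series_unique _ _ H2).
  eapply Rle_trans; [apply Series_Rabs|].
  - apply (ex_series_dominated _ (fun n => Rabs (c true (S N + n)%nat) + Rabs (c false (S N + n)%nat))).
    + intro n. rewrite Rabs_Rabsolu. apply trig_term_bound.
    + eexists; apply H2.
  - apply Series_le.
    + intro n. split; [apply Rabs_pos|apply trig_term_bound].
    + eexists; apply H2.
Qed.

Lemma tail_lim c : summable c -> is_lim_seq (tail c) 0.
Proof.
  intro H. unfold tail.
  set (l := Series _).
  replace (Finite 0) with (Finite (l - l)) by (f_equal; ring).
  apply is_lim_seq_minus'; [apply is_lim_seq_const|].
  apply (Series_correct _ H).
Qed.

Lemma cont_sum_n (F : nat -> R -> R) N : (forall n, cont (F n)) ->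
  cont (fun x => sum_n (fun n => F n x) N).
Proof.
  intro H. induction N as [|N IH].
  - replace (fun x => sum_n (fun n => F n x) 0) with (F 0%nat); [apply H|].
    apply functional_extensionality. intro x. now rewrite sum_O.
  - replace (fun x => sum_n (fun n => F n x) (S N))
      with (fun x => sum_n (fun n => F n x) N + F (S N) x); [now apply cont_plus|].
    apply functional_extensionality. intro x. now rewrite sum_n_S.
Qed.

Lemma cont_trig_term c n : cont (fun x => trig_term c x n).
Proof. unfold trig_term. auto with cont. Qed.
#[local] Hint Resolve cont_trig_term : cont.

(** A uniform limit of continuous functions: [tail] bounds the remainder for all x at
    once. *)
Lemma cont_trig_series c : summable c -> cont (trig_series c).
Proof.
  intros H x. apply continuity_pt_filterlim.
  apply (CVU_continuity (fun N x => sum_n (trig_term c x) N) _ x (mkposreal 1 Rlt_0_1)).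
  - intros eps Heps.
    destruct (proj2 (is_lim_seq_spec _ _) (tail_lim c H) (mkposreal eps Heps)) as [N HN].
    exists N. intros n y Hn _. specialize (HN n Hn). simpl in HN.
    rewrite Rminus_0_r in HN. apply Rle_lt_trans with (2 := HN).
    eapply Rle_trans; [now apply trig_series_tail|]. apply Rle_abs.
  - intros n y _. apply continuity_pt_filterlim.
    apply (cont_sum_n (fun n x => trig_term c x n)). auto with cont.
  - unfold Boule. simpl. rewrite Rminus_diag, Rabs_R0. lra.
Qed.
#[local] Hint Resolve cont_trig_series : cont.

Lemma periodic_trig_series c : periodic (trig_series c).
Proof.
  intro x. apply Series_ext. intro n. unfold trig_term. now rewrite !periodic_trig.
Qed.

Lemma integral_sum_n (F : nat -> R -> R) N : (forall n, cont (F n)) ->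
  integral (fun x => sum_n (fun n => F n x) N) = sum_n (fun n => integral (F n)) N.
Proof.
  intro H. induction N as [|N IH].
  - rewrite sum_O. apply integral_ext. intro. now rewrite sum_O.
  - rewrite sum_n_S, <- IH.
    rewrite <- integral_plus; auto using cont_sum_n.
    apply integral_ext. intro. now rewrite sum_n_S.
Qed.

Lemma cont_bounded (f : R -> R) : cont f ->
  exists M, 0 <= M /\ forall x, - PI <= x <= PI -> Rabs (f x) <= M.
Proof.
  intro Hf.
  destruct (continuity_ab_maj (fun x => Rabs (f x)) (- PI) PI) as [x0 [H _]].
  - generalize PI_RGT_0; lra.
  - intros. apply continuity_pt_filterlim. now apply cont_abs.
  - exists (Rabs (f x0)). split; [apply Rabs_pos | exact H].
Qed.

Lemma abs_integral_le (f : R -> R) M : cont f -> (forall x, - PI <= x <= PI -> Rabs (f x) <= M) ->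
  Rabs (integral f) <= 2 * PI * M.
Proof.
  intros Hf H. replace (2 * PI * M) with ((PI - - PI) * M) by ring.
  apply abs_RInt_le_const; auto using cont_ex_RInt. generalize PI_RGT_0; lra.
Qed.

Definition pairing (c e : bool -> nat -> R) (n : nat) : R :=
  c true n * e true n + c false n * e false n.

Lemma is_lim_seq_squeeze (u t : nat -> R) (l : R) :
  (forall n, Rabs (l - u n) <= t n) -> is_lim_seq t 0 -> is_lim_seq u l.
Proof.
  intros H Ht.
  apply is_lim_seq_le_le with (fun n => l - t n) (fun n => l + t n).
  - intro n. specialize (H n). apply Rabs_le_between in H. lra.
  - replace (Finite l) with (Finite (l - 0)) by (f_equal; ring).
    apply is_lim_seq_minus'; trivial. apply is_lim_seq_const.
  - replace (Finite l) with (Finite (l + 0)) by (f_equal; ring).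
    apply is_lim_seq_plus'; trivial. apply is_lim_seq_const.
Qed.

(** Integration term by term, allowed since the remainder is at most [tail c N] for
    every x and [f] is bounded on a period. *)
Lemma integral_mult_trig_series (f : R -> R) c : cont f -> summable c ->
  is_series (fun n => PI * pairing c (fun b n => coef b f (S n)) n)
    (integral (fun x => f x * trig_series c x)).
Proof.
  intros Hf Hc.
  destruct (cont_bounded f Hf) as (M & HM0 & HM).
  change (is_lim_seq (sum_n (fun n => PI * pairing c (fun b n => coef b f (S n)) n))
     (integral (fun x => f x * trig_series c x))).
  apply is_lim_seq_ext with (fun N => integral (fun x => f x * sum_n (trig_term c x) N)).
  { intro N.
    rewrite (integral_ext _ (fun x => sum_n (fun n => f x * trig_term c x n) N)).
    2:{ intro x. now rewrite (sum_n_mult_l (K := R_Ring) (f x)). }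
    rewrite (integral_sum_n (fun n x => f x * trig_term c x n)) by auto with cont.
    apply sum_n_ext. intro n.
    unfold trig_term, pairing.
    rewrite (integral_ext _ (fun x => c true n * (f x * trig true (S n) x)
       + c false n * (f x * trig false (S n) x))) by (intro; ring).
    rewrite integral_plus, !integral_scal, !integral_coef by auto with cont.
    (* The equation lives in an abelian monoid that unfolds to R. *)
    match goal with |- ?a = ?b => change (@eq R a b) end. ring. }
  apply (is_lim_seq_squeeze _ (fun N => 2 * PI * M * tail c N)).
  - intro N.
    assert (Hs : cont (fun x => sum_n (trig_term c x) N)).
    { apply (cont_sum_n (fun n x => trig_term c x n)). auto with cont. }
    rewrite <- integral_minus by auto with cont.
    rewrite Rmult_assoc. apply abs_integral_le; [auto with cont|].
    intros x Hx. rewrite <- Rmult_minus_distr_l, Rabs_mult.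
    apply Rmult_le_compat; auto using Rabs_pos. now apply trig_series_tail.
  - replace (Finite 0) with (Finite (2 * PI * M * 0)) by (f_equal; ring).
    apply is_lim_seq_mult'; [apply is_lim_seq_const|now apply tail_lim].
Qed.

(** * Completeness of the trigonometric system *)

Lemma integral_shift_period (f : R -> R) (a : R) : cont f -> periodic f ->
  integral (fun x => f (x + a)) = integral f.
Proof.
  intros Hf Hp.
  assert (E : forall u v, ex_RInt f u v) by (intros; now apply cont_ex_RInt).
  assert (Hs : forall c u v, RInt (fun x => f (x + c)) u v = RInt f (u + c) (v + c)).
  { intros c u v.
    generalize (RInt_comp_lin f 1 c u v). rewrite !Rmult_1_l.
    intro H. rewrite <- H by apply E. apply RInt_ext. intros x _.
    now rewrite !Rmult_1_l. }
  unfold integral. rewrite Hs.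
  rewrite <- (RInt_Chasles f (- PI + a) (- PI) (PI + a)) by apply E.
  rewrite <- (RInt_Chasles f (- PI) PI (PI + a)) by apply E.
  assert (H := Hs (2 * PI) (- PI) (- PI + a)).
  rewrite (RInt_ext _ f) in H by (intros x _; apply Hp).
  replace (- PI + 2 * PI) with PI in H by ring.
  replace (- PI + a + 2 * PI) with (PI + a) in H by ring.
  rewrite <- H, <- (opp_RInt_swap f (- PI) (- PI + a)) by apply E.
  set (X := RInt f (- PI) (- PI + a)). set (Y := RInt f (- PI) PI).
  change (- X + (Y + X) = Y). ring.
Qed.

(** The product of cos x and cos (n x) is a combination of two cosines, so orthogonality
    to all cosines survives multiplication by 1 + cos x. *)
Lemma cos_orthogonal_step (f : R -> R) (c : R) : cont f ->
  (forall n, integral (fun x => f x * cos (INR n * x)) = 0) ->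
  forall n, integral (fun x => f x * (c * (1 + cos x)) * cos (INR n * x)) = 0.
Proof.
  intros Hf H n.
  assert (Hc : forall n, cont (fun x => cos (INR n * x))) by exact (cont_trig true).
  assert (E : exists p, forall x,
    cos x * cos (INR n * x) = / 2 * cos (INR (S n) * x) + / 2 * cos (INR p * x)).
  { destruct n as [|n].
    - exists 1%nat. intro x. simpl. rewrite Rmult_0_l, cos_0, Rmult_1_l. field.
    - exists n. intro x. rewrite (S_INR (S n)).
      replace (INR n * x) with (INR (S n) * x - x) by (rewrite S_INR; ring).
      replace ((INR (S n) + 1) * x) with (INR (S n) * x + x) by ring.
      rewrite cos_plus, cos_minus. field. }
  destruct E as [p E].
  rewrite (integral_ext _ (fun x => c * (f x * cos (INR n * x))
     + (c * / 2 * (f x * cos (INR (S n) * x)) + c * / 2 * (f x * cos (INR p * x))))).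
  - rewrite !integral_plus, !integral_scal, !H by auto 6 with cont. ring.
  - intro x.
    replace (f x * (c * (1 + cos x)) * cos (INR n * x))
      with (c * (f x * cos (INR n * x)) + c * f x * (cos x * cos (INR n * x))) by ring.
    rewrite E. ring.
Qed.

Lemma cos_orthogonal_pow (f : R -> R) (c : R) (N : nat) : cont f ->
  (forall n, integral (fun x => f x * cos (INR n * x)) = 0) ->
  integral (fun x => f x * (c * (1 + cos x)) ^ N) = 0.
Proof.
  intros Hf H.
  assert (Hc : cont cos) by (apply derivable_cont; intro; auto_derive; trivial).
  assert (G : forall n, integral (fun x => f x * (c * (1 + cos x)) ^ N * cos (INR n * x)) = 0).
  { induction N as [|N IH]; intro n.
    - rewrite <- (H n). apply integral_ext. intro x. simpl. ring.
    - rewrite <- (cos_orthogonal_step (fun x => f x * (c * (1 + cos x)) ^ N) c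
                    ltac:(auto 7 with cont) IH n).
      apply integral_ext. intro x. simpl. ring. }
  rewrite <- (G 0%nat). apply integral_ext. intro x. simpl.
  rewrite Rmult_0_l, cos_0. ring.
Qed.

(** The powers of K(x) = (1 + cos x) / (1 + cos d) concentrate at 0: K > 1 for |x| < d
    and 0 <= K <= 1 elsewhere on the period.  If f(0) > 0, choose d so that f > f(0) / 2
    on [-d, d]; then the integral of f K^N over [-d, d] is unbounded in N by
    Bernoulli's inequality, while the rest stays bounded, and the total cannot vanish. *)
Lemma cos_orthogonal_nonpos (f : R -> R) : cont f ->
  (forall n, integral (fun x => f x * cos (INR n * x)) = 0) -> f 0 <= 0.
Proof.
  intros Hf H. apply Rnot_lt_le. intro Hpos.
  assert (HPI := PI_RGT_0).
  assert (Hc : cont cos) by (apply derivable_cont; intro; auto_derive; trivial).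
  assert (HN : exists del, 0 < del /\ del < PI / 2 /\
    forall x, - del <= x <= del -> f 0 / 2 <= f x).
  { destruct (proj1 (filterlim_locally f (f 0)) (Hf 0) (mkposreal (f 0 / 2) ltac:(lra)))
      as [e He].
    (* d < PI / 2 makes cos d positive, so that K is well defined. *)
    exists (Rmin (e / 2) (PI / 4)).
    assert (He0 := cond_pos e).
    assert (H1 := Rmin_l (e / 2) (PI / 4)). assert (H2 := Rmin_r (e / 2) (PI / 4)).
    repeat split.
    - apply Rmin_pos; lra.
    - lra.
    - intros x Hx.
      assert (B : ball 0 e x).
      { change (Rabs (x - 0) < e). rewrite Rminus_0_r.
        apply Rle_lt_trans with (e / 2); [|lra]. apply Rabs_le; lra. }
      specialize (He x B). change (Rabs (f x - f 0) < f 0 / 2) in He.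
      apply Rabs_lt_between in He. lra. }
  destruct HN as (d & Hd0 & Hd1 & Hd).
  assert (Hcd : 0 < cos d) by (apply cos_gt_0; lra).
  set (c := / (1 + cos d)).
  assert (Hc0 : 0 < c) by (apply Rinv_0_lt_compat; lra).
  set (K := fun x => c * (1 + cos x)).
  assert (HK : cont K) by (unfold K; auto with cont).
  assert (HK0 : forall x, 0 <= K x).
  { intro x. unfold K. apply Rmult_le_pos; [lra|]. generalize (COS_bound x). lra. }
  assert (HKd : K d = 1) by (unfold K, c; field; lra).
  assert (Keven : forall x, K (- x) = K x) by (intro; unfold K; now rewrite cos_neg).
  assert (HKout : forall x, d <= x <= PI -> K x <= 1).
  { intros x Hx. rewrite <- HKd. unfold K. apply Rmult_le_compat_l; [lra|].
    apply Rplus_le_compat_l. apply cos_decr_1; lra. }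
  assert (HKin0 : forall x, 0 <= x < d -> 1 < K x).
  { intros x Hx. rewrite <- HKd. unfold K. apply Rmult_lt_compat_l; [lra|].
    apply Rplus_lt_compat_l. apply cos_decreasing_1; lra. }
  assert (HKin : forall x, - d < x < d -> 1 < K x).
  { intros x Hx. destruct (Rle_dec 0 x); [|rewrite <- Keven]; apply HKin0; lra. }
  destruct (cont_bounded f Hf) as (M & HM0 & HM).
  set (kap := RInt (fun x => K x - 1) (- d) d).
  assert (Hkap : 0 < kap).
  { apply RInt_gt_0; [lra| |].
    - intros x Hx. generalize (HKin x Hx). lra.
    - intros x _. apply (cont_minus K); auto with cont. }
  destruct (INR_unbounded ((2 * PI * M + 1) / (f 0 / 2 * kap))) as [N HN].
  assert (Z := cos_orthogonal_pow f c N Hf H).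
  change (RInt (fun x => f x * K x ^ N) (- PI) PI = 0) in Z.
  assert (E : forall u v, ex_RInt (fun x => f x * K x ^ N) u v)
    by (intros; apply cont_ex_RInt; auto with cont).
  rewrite <- (RInt_Chasles _ (- PI) (- d) PI) in Z by apply E.
  rewrite <- (RInt_Chasles _ (- d) d PI) in Z by apply E.
  set (I1 := RInt _ (- PI) (- d)) in Z.
  set (I2 := RInt _ (- d) d) in Z. set (I3 := RInt _ d PI) in Z.
  change (I1 + (I2 + I3) = 0) in Z.
  assert (Hout : forall x, (d <= x <= PI \/ - PI <= x <= - d) -> Rabs (f x * K x ^ N) <= M).
  { intros x Hx. rewrite Rabs_mult. rewrite <- (Rmult_1_r M).
    apply Rmult_le_compat; try apply Rabs_pos.
    - apply HM. lra.
    - rewrite <- RPow_abs. rewrite Rabs_right by (apply Rle_ge, HK0).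
      rewrite <- (pow1 N). apply pow_incr. split; [apply HK0|].
      destruct Hx; [|rewrite <- Keven]; apply HKout; lra. }
  assert (B1 : Rabs I1 <= (- d - - PI) * M).
  { apply abs_RInt_le_const; [lra|apply E|]. intros; apply Hout; lra. }
  assert (B3 : Rabs I3 <= (PI - d) * M).
  { apply abs_RInt_le_const; [lra|apply E|]. intros; apply Hout; lra. }
  assert (B2 : f 0 / 2 * (INR N * kap) <= I2).
  { assert (E1 : ex_RInt (fun x => K x - 1) (- d) d) by (apply cont_ex_RInt; auto with cont).
    replace (f 0 / 2 * (INR N * kap)) with (RInt (fun x => f 0 / 2 * INR N * (K x - 1)) (- d) d).
    - apply RInt_le; [lra| |apply E|].
      + apply cont_ex_RInt; auto with cont.
      + intros x Hx.
        assert (1 + INR N * (K x - 1) <= K x ^ N).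
        { replace (K x) with (1 + (K x - 1)) at 2 by ring.
          apply poly. generalize (HKin x Hx); lra. }
        assert (Hfx := Hd x ltac:(lra)).
        apply Rle_trans with (f 0 / 2 * K x ^ N).
        * rewrite Rmult_assoc. apply Rmult_le_compat_l; lra.
        * apply Rmult_le_compat_r; [apply pow_le, HK0|trivial].
    - etransitivity; [exact (RInt_scal (fun x => K x - 1) (- d) d (f 0 / 2 * INR N) E1)|].
      exact (Rmult_assoc (f 0 / 2) (INR N) kap). }
  apply Rabs_le_between in B1. apply Rabs_le_between in B3.
  assert (Hk : 0 < f 0 / 2 * kap) by (apply Rmult_lt_0_compat; lra).
  apply Rlt_div_l in HN; [|exact Hk].
  nra.
Qed.

(** Translating the point of interest to 0 keeps all coefficients zero and leaves only
    orthogonality to cosines to be used. *)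
Lemma trig_complete (f : R -> R) : cont f -> periodic f -> integral f = 0 ->
  (forall b n, coef b f (S n) = 0) -> forall x, f x = 0.
Proof.
  intros Hf Hp H0 H a.
  assert (Hcos : forall n, integral (fun x => f x * cos (INR n * x)) = 0
                 /\ integral (fun x => f x * sin (INR n * x)) = 0).
  { intros [|n].
    - rewrite <- H0. split.
      + apply integral_ext. intro x. simpl. rewrite Rmult_0_l, cos_0. ring.
      + rewrite (integral_ext _ (fun x => 0 * f x)).
        * rewrite integral_scal, H0 by trivial. ring.
        * intro x. simpl. rewrite Rmult_0_l, sin_0. ring.
    - assert (Hb : forall b, integral (fun x => f x * trig b (S n) x) = 0)
        by (intro b; rewrite integral_coef, H; ring).
      exact (conj (Hb true) (Hb false)). }
  assert (Hs : cont (fun x => f (x + a))).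
  { intro x. apply (continuous_comp (fun x => x + a) f); [|apply Hf].
    apply (cont_plus (fun x => x)); auto with cont. }
  assert (Ha : forall n, integral (fun x => f (x + a) * cos (INR n * x)) = 0).
  { intro n.
    assert (Ht := cont_trig true n). assert (Hu := cont_trig false n). unfold trig in Ht, Hu.
    set (u := fun y => cos (INR n * a) * (f y * cos (INR n * y))
                + sin (INR n * a) * (f y * sin (INR n * y))).
    rewrite (integral_ext _ (fun x => u (x + a))).
    - rewrite integral_shift_period.
      + unfold u. rewrite integral_plus, !integral_scal by auto with cont.
        destruct (Hcos n) as [-> ->]. ring.
      + unfold u. auto 6 with cont.
      + intro x. unfold u. destruct (cos_sin_shift n x) as [-> ->]. now rewrite Hp.
    - intro x. unfold u.
      replace (INR n * x) with (INR n * (x + a) - INR n * a) by ring.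
      rewrite cos_minus. ring. }
  apply Rle_antisym.
  - rewrite <- (Rplus_0_l a). exact (cos_orthogonal_nonpos _ Hs Ha).
  - cut (- f (0 + a) <= 0); [rewrite Rplus_0_l; lra|].
    apply (cos_orthogonal_nonpos (fun x => - f (x + a))); auto with cont.
    intro n. rewrite <- (Ropp_0), <- (Ha n).
    rewrite (integral_ext _ (fun x => -1 * (f (x + a) * cos (INR n * x)))) by (intro; ring).
    assert (Ht := cont_trig true n). unfold trig in Ht.
    rewrite integral_scal by auto with cont. ring.
Qed.

Lemma is_series_single (n : nat) (y : R) :
  is_series (fun m => if Nat.eqb m n then y else 0) y.
Proof.
  assert (T : forall N, @eq R (sum_n (fun m => if Nat.eqb m n then y else 0) N)
                (if Nat.leb n N then y else 0)).
  { induction N as [|N IH].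
    - rewrite sum_O. destruct n; reflexivity.
    - rewrite sum_n_S, IH.
      destruct (Nat.leb_spec n N), (Nat.leb_spec n (S N)), (Nat.eqb_spec (S N) n);
        try lia; ring. }
  change (is_lim_seq (sum_n (fun m => if Nat.eqb m n then y else 0)) y).
  apply (is_lim_seq_ext_loc (fun _ => y)); [|apply is_lim_seq_const].
  exists n. intros N HN. symmetry. etransitivity; [exact (T N)|].
  destruct (Nat.leb_spec n N); trivial; lia.
Qed.

Lemma coef_trig_series (b : bool) c (n : nat) : summable c ->
  coef b (trig_series c) (S n) = c b n.
Proof.
  intro H. unfold coef.
  rewrite (integral_ext _ (fun x => trig b (S n) x * trig_series c x)) by (intro; ring).
  rewrite <- (is_series_unique _ _
    (integral_mult_trig_series (trig b (S n)) c (cont_trig b (S n)) H)).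
  rewrite (Series_ext _ (fun m => if Nat.eqb m n then PI * c b n else 0)).
  - rewrite (is_series_unique _ _ (is_series_single n _)). field. apply PI_neq0.
  - intro m. unfold pairing. rewrite !coef_trig.
    destruct (Nat.eqb_spec m n) as [->|]; destruct b; simpl; ring.
Qed.

Lemma coef_one (b : bool) (n : nat) : coef b (fun _ => 1) (S n) = 0.
Proof.
  unfold coef. rewrite (integral_ext _ (trig b (S n))) by (intro; ring).
  rewrite integral_trig. ring.
Qed.

Lemma integral_trig_series c : summable c -> integral (trig_series c) = 0.
Proof.
  intro H.
  assert (HS := integral_mult_trig_series (fun _ => 1) c ltac:(auto with cont) H).
  apply is_series_unique in HS.
  rewrite (integral_ext _ (fun x => 1 * trig_series c x)) by (intro; ring).
  rewrite <- HS. rewrite (Series_ext _ (fun n => 0 * 0)).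
  - rewrite Series_scal_l. ring.
  - intro n. unfold pairing. rewrite !coef_one. ring.
Qed.

(** The absolutely convergent series has the same coefficients as [f], hence equals [f]
    by completeness. *)
Lemma fourier_series (f : R -> R) (x : R) : periodic_C1 f ->
  f x = mean f + trig_series (fun b n => coef b f (S n)) x.
Proof.
  intro Hf. set (c := fun b n => coef b f (S n)).
  assert (Hc : summable c) by now apply summable_coef.
  apply Rminus_diag_uniq.
  apply (trig_complete (fun x => f x - (mean f + trig_series c x))).
  - auto with cont.
  - intro y. rewrite periodic_trig_series. destruct Hf as [-> _]. reflexivity.
  - rewrite integral_minus, integral_plus, integral_const, integral_trig_series,
      integral_mean by auto with cont.
    ring.
  - intros b n.
    rewrite (coef_ext _ _ (fun x => (f x - trig_series c x) - mean f * 1)) by (intro; ring).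
    rewrite coef_minus, coef_minus, coef_scal, coef_trig_series by auto with cont.
    rewrite coef_one. unfold c. ring.
Qed.

Lemma parseval (f u : R -> R) : cont f -> periodic_C1 u -> integral u = 0 ->
  is_series (fun n => PI * pairing (fun b n => coef b u (S n)) (fun b n => coef b f (S n)) n)
    (integral (fun x => f x * u x)).
Proof.
  intros Hf Hu H0.
  rewrite (integral_ext _ (fun x => f x * trig_series (fun b n => coef b u (S n)) x)).
  - apply integral_mult_trig_series; auto using summable_coef.
  - intro x. rewrite (fourier_series u x Hu) at 1. rewrite mean_integral, H0. ring.
Qed.

(** * Periodic functions of class C^1 and C^2 *)

Lemma Derive_plus_fun (f g : R -> R) : (forall x, ex_derive f x) -> (forall x, ex_derive g x) ->
  Derive (fun x => f x + g x) = fun x => Derive f x + Derive g x.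
Proof. intros. apply functional_extensionality. intro. now apply Derive_plus. Qed.

Lemma Derive_mult_fun (f g : R -> R) : (forall x, ex_derive f x) -> (forall x, ex_derive g x) ->
  Derive (fun x => f x * g x) = fun x => Derive f x * g x + f x * Derive g x.
Proof. intros. apply functional_extensionality. intro. now apply Derive_mult. Qed.

Lemma periodic_C1_const (c : R) : periodic_C1 (fun _ => c).
Proof.
  split; [intro; reflexivity|split].
  - intro. apply ex_derive_const.
  - replace (Derive (fun _ => c)) with (fun _ : R => 0); auto with cont.
    apply functional_extensionality. intro. now rewrite Derive_const.
Qed.

Lemma periodic_C1_plus (f g : R -> R) :
  periodic_C1 f -> periodic_C1 g -> periodic_C1 (fun x => f x + g x).
Proof.
  intros Hf Hg.
  assert (Cf := periodic_C1_cont_Derive f Hf).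
  assert (Cg := periodic_C1_cont_Derive g Hg).
  destruct Hf as (Pf & Df & _), Hg as (Pg & Dg & _).
  split; [intro; now rewrite Pf, Pg|split].
  - intro. now apply (ex_derive_plus f g).
  - rewrite Derive_plus_fun; auto with cont.
Qed.

Lemma periodic_C1_mult (f g : R -> R) :
  periodic_C1 f -> periodic_C1 g -> periodic_C1 (fun x => f x * g x).
Proof.
  intros Hf Hg.
  assert (Cf := periodic_C1_cont_Derive f Hf).
  assert (Cg := periodic_C1_cont_Derive g Hg).
  assert (Cf' := periodic_C1_cont f Hf). assert (Cg' := periodic_C1_cont g Hg).
  destruct Hf as (Pf & Df & _), Hg as (Pg & Dg & _).
  split; [intro; now rewrite Pf, Pg|split].
  - intro. now apply (ex_derive_mult f g).
  - rewrite Derive_mult_fun; auto with cont.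
Qed.

Definition periodic_C2 (f : R -> R) : Prop :=
  periodic f /\ (forall x, ex_derive f x) /\ periodic_C1 (Derive f).

Lemma periodic_C2_periodic_C1 f : periodic_C2 f -> periodic_C1 f.
Proof. intros (P & D & H). split; trivial. split; trivial. now apply periodic_C1_cont. Qed.

Lemma periodic_C2_Derive f : periodic_C2 f -> periodic_C1 (Derive f).
Proof. now intros (_ & _ & H). Qed.

Lemma periodic_C2_const (c : R) : periodic_C2 (fun _ => c).
Proof.
  split; [intro; reflexivity|split].
  - intro. apply ex_derive_const.
  - replace (Derive (fun _ => c)) with (fun _ : R => 0); [apply periodic_C1_const|].
    apply functional_extensionality. intro. now rewrite Derive_const.
Qed.

Lemma periodic_C2_plus (f g : R -> R) :
  periodic_C2 f -> periodic_C2 g -> periodic_C2 (fun x => f x + g x).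
Proof.
  intros Hf Hg. destruct (periodic_C1_plus f g) as (P & D & _); auto using periodic_C2_periodic_C1.
  split; trivial. split; trivial.
  rewrite Derive_plus_fun by (apply Hf || apply Hg).
  apply periodic_C1_plus; now apply periodic_C2_Derive.
Qed.

Lemma periodic_C2_mult (f g : R -> R) :
  periodic_C2 f -> periodic_C2 g -> periodic_C2 (fun x => f x * g x).
Proof.
  intros Hf Hg. destruct (periodic_C1_mult f g) as (P & D & _); auto using periodic_C2_periodic_C1.
  split; trivial. split; trivial.
  rewrite Derive_mult_fun by (apply Hf || apply Hg).
  apply periodic_C1_plus; apply periodic_C1_mult;
    auto using periodic_C2_periodic_C1, periodic_C2_Derive.
Qed.

Lemma periodic_C2_opp (f : R -> R) : periodic_C2 f -> periodic_C2 (fun x => - f x).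
Proof.
  intro Hf. replace (fun x => - f x) with (fun x => -1 * f x).
  - apply periodic_C2_mult; auto using periodic_C2_const.
  - apply functional_extensionality. intro; ring.
Qed.

Lemma periodic_C2_minus (f g : R -> R) :
  periodic_C2 f -> periodic_C2 g -> periodic_C2 (fun x => f x - g x).
Proof. intros Hf Hg. apply periodic_C2_plus; trivial. now apply periodic_C2_opp. Qed.

Lemma periodic_C2_pow (f : R -> R) n : periodic_C2 f -> periodic_C2 (fun x => f x ^ n).
Proof.
  intro Hf. induction n as [|n IH]; simpl.
  - apply periodic_C2_const.
  - now apply periodic_C2_mult.
Qed.

Lemma periodic_C2_trig b n : periodic_C2 (trig b n).
Proof.
  destruct (periodic_C1_trig b n) as (P & D & _). split; trivial. split; trivial.
  rewrite Derive_trig. apply (periodic_C1_mult (fun _ => deriv_sign b * INR n));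
    auto using periodic_C1_const, periodic_C1_trig.
Qed.

Create HintDb smooth.
#[local] Hint Resolve periodic_C2_const periodic_C2_plus periodic_C2_mult periodic_C2_opp
  periodic_C2_minus periodic_C2_pow periodic_C2_trig : smooth.
#[local] Hint Resolve periodic_C2_periodic_C1 periodic_C2_Derive : smooth.

Lemma periodic_C2_cont f : periodic_C2 f -> cont f.
Proof. auto using periodic_C1_cont, periodic_C2_periodic_C1. Qed.
Lemma periodic_C2_cont_Derive f : periodic_C2 f -> cont (Derive f).
Proof. auto using periodic_C1_cont_Derive, periodic_C2_periodic_C1. Qed.
#[local] Hint Resolve periodic_C2_cont periodic_C2_cont_Derive : cont.

(** * The hyperbolic cotangent *)

Lemma coth_exp x : coth x = (exp x + exp (- x)) / (exp x - exp (- x)).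
Proof.
  unfold coth, cosh, sinh. destruct (Req_dec (exp x - exp (- x)) 0) as [E|E].
  - rewrite E. unfold Rdiv. now rewrite Rmult_0_l, Rinv_0, !Rmult_0_r.
  - field. trivial.
Qed.

Lemma exp_minus_pos x : 0 < x -> 0 < exp x - exp (- x).
Proof. intro. assert (exp (- x) < exp x) by (apply exp_increasing; lra). lra. Qed.

Lemma coth_bounds x : 0 < x -> 1 <= coth x <= 1 + / x.
Proof.
  intro Hx. rewrite coth_exp.
  assert (H := exp_minus_pos x Hx).
  assert (E : exp x * exp (- x) = 1) by (rewrite <- exp_plus, Rplus_opp_r; apply exp_0).
  assert (L := exp_ineq1_le x). assert (P := exp_pos (- x)).
  split.
  - apply Rle_div_r; lra.
  - apply Rle_div_l; trivial.
    apply Rmult_le_reg_l with x; trivial.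
    replace (x * ((1 + / x) * (exp x - exp (- x)))) with ((x + 1) * (exp x - exp (- x)))
      by (field; lra).
    apply Rmult_le_reg_l with (exp x); [apply exp_pos|].
    nra.
Qed.

Lemma is_derive_coth x : 0 < x -> is_derive coth x (1 - coth x ^ 2).
Proof.
  intro Hx. assert (H := exp_minus_pos x Hx).
  apply (is_derive_ext (fun x => (exp x + exp (- x)) / (exp x - exp (- x)))).
  - intro. symmetry. apply coth_exp.
  - rewrite coth_exp. auto_derive; [lra|]. field. lra.
Qed.

(** The constant does not depend on [N], which is what allows differentiating a series
    over [N] under the sole assumption that its weights are summable.  The second
    derivative of coth(N z) / N is 2 N coth (coth^2 - 1) at N z, and coth t <= 1 + 1 / t
    gives N (coth^2 - 1) <= 2 / z + 1 / (N z^2); use this for z > x / 2. *)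
Lemma coth_scaled_taylor (N x y : R) : 1 <= N -> 0 < x -> Rabs (y - x) < x / 2 ->
  Rabs (coth (N * y) / N - coth (N * x) / N - (y - x) * (1 - coth (N * x) ^ 2))
  <= (y - x) ^ 2 * (2 * (1 + 2 / x) * (4 / x + 4 / x ^ 2)).
Proof.
  intros HN Hx Hy. apply Rabs_lt_between in Hy.
  set (B := 2 * (1 + 2 / x) * (4 / x + 4 / x ^ 2)).
  assert (Hpos : forall z, x / 2 < z -> 0 < N * z) by (intros; apply Rmult_lt_0_compat; lra).
  assert (D1 : forall z, x / 2 < z -> is_derive (fun z => coth (N * z) / N) z (1 - coth (N * z) ^ 2)).
  { intros z Hz. assert (Hd := is_derive_coth _ (Hpos z Hz)).
    assert (Hu := is_derive_unique _ _ _ Hd).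
    auto_derive; [now exists (1 - coth (N * z) ^ 2)|].
    change (fun x0 => coth x0) with coth. rewrite Hu. field. lra. }
  assert (D2 : forall z, x / 2 < z -> is_derive (fun z => 1 - coth (N * z) ^ 2) z
     (- 2 * N * coth (N * z) * (1 - coth (N * z) ^ 2))).
  { intros z Hz. assert (Hd := is_derive_coth _ (Hpos z Hz)).
    assert (Hu := is_derive_unique _ _ _ Hd).
    auto_derive; [now exists (1 - coth (N * z) ^ 2)|].
    change (fun x0 => coth x0) with coth. rewrite Hu. ring. }
  assert (B2 : forall z, x / 2 < z -> Rabs (- 2 * N * coth (N * z) * (1 - coth (N * z) ^ 2)) <= B).
  { intros z Hz. assert (H := coth_bounds _ (Hpos z Hz)).
    set (T := coth (N * z)) in *.
    assert (Hz2 : 0 < / z < 2 / x).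
    { split; [apply Rinv_0_lt_compat; lra|].
      replace (2 / x) with (/ (x / 2)) by (field; lra).
      apply Rinv_lt_contravar; [apply Rmult_lt_0_compat|]; lra. }
    assert (HNi : 0 < / N <= 1).
    { split; [apply Rinv_0_lt_compat; lra|]. rewrite <- Rinv_1. apply Rinv_le_contravar; lra. }
    rewrite Rinv_mult in H.
    set (s := / N) in *. set (t := / z) in *.
    assert (HNs : N * s = 1) by (unfold s; field; lra).
    replace (- 2 * N * T * (1 - T ^ 2)) with (2 * T * (N * (T ^ 2 - 1))) by ring.
    assert (Q : 0 <= N * (T ^ 2 - 1) <= 4 / x + 4 / x ^ 2).
    { split; [apply Rmult_le_pos; nra|].
      apply Rle_trans with (N * ((1 + s * t) ^ 2 - 1)).
      - apply Rmult_le_compat_l; [lra|]. nra.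
      - replace (N * ((1 + s * t) ^ 2 - 1)) with ((N * s) * (2 * t + s * t ^ 2)) by ring.
        rewrite HNs, Rmult_1_l.
        replace (4 / x + 4 / x ^ 2) with (2 * (2 / x) + (2 / x) ^ 2) by (field; lra).
        nra. }
    assert (QT : 0 <= 2 * T <= 2 * (1 + 2 / x)) by nra.
    rewrite Rabs_right by (apply Rle_ge, Rmult_le_pos; lra).
    unfold B. apply Rmult_le_compat; lra. }
  assert (B1 : forall z, x / 2 < z -> Rabs ((1 - coth (N * z) ^ 2) - (1 - coth (N * x) ^ 2))
     <= B * Rabs (z - x)).
  { intros z Hz.
    destruct (MVT_gen (fun z => 1 - coth (N * z) ^ 2) x z
       (fun z => - 2 * N * coth (N * z) * (1 - coth (N * z) ^ 2))) as (c & Hc & E).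
    - intros t Ht. apply D2.
      apply Rlt_trans with (2 := proj1 Ht). apply Rmin_glb_lt; lra.
    - intros t Ht. apply continuity_pt_filterlim.
      apply (ex_derive_continuous (fun z => 1 - coth (N * z) ^ 2)).
      eexists. apply D2. apply Rlt_le_trans with (2 := proj1 Ht). apply Rmin_glb_lt; lra.
    - rewrite E, Rabs_mult. apply Rmult_le_compat_r; [apply Rabs_pos|]. apply B2.
      apply Rlt_le_trans with (2 := proj1 Hc). apply Rmin_glb_lt; lra. }
  destruct (MVT_gen (fun z => coth (N * z) / N - z * (1 - coth (N * x) ^ 2)) x y
       (fun z => (1 - coth (N * z) ^ 2) - (1 - coth (N * x) ^ 2))) as (c & Hc & E).
  - intros t Ht. apply (is_derive_minus (fun z => coth (N * z) / N)).
    + apply D1. apply Rlt_trans with (2 := proj1 Ht). apply Rmin_glb_lt; lra.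
    + auto_derive; trivial. ring.
  - intros t Ht. apply continuity_pt_filterlim.
    apply (continuous_minus (fun z => coth (N * z) / N)
             (fun z => z * (1 - coth (N * x) ^ 2))).
    + apply (ex_derive_continuous (fun z => coth (N * z) / N)). eexists. apply D1.
      apply Rlt_le_trans with (2 := proj1 Ht). apply Rmin_glb_lt; lra.
    + apply (cont_mult (fun z => z)); auto with cont.
  - replace (coth (N * y) / N - coth (N * x) / N - (y - x) * (1 - coth (N * x) ^ 2))
      with (((1 - coth (N * c) ^ 2) - (1 - coth (N * x) ^ 2)) * (y - x)) by (rewrite <- E; ring).
    rewrite Rabs_mult.
    assert (Hcx : Rabs (c - x) <= Rabs (y - x)).
    { revert Hc. unfold Rmin, Rmax. destruct (Rle_dec x y); intro Hc.
      - rewrite !Rabs_right; lra.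
      - rewrite !Rabs_left1; lra. }
    assert (HB : 0 <= B) by (eapply Rle_trans; [apply Rabs_pos | apply (B2 x); lra]).
    replace ((y - x) ^ 2 * B) with (B * Rabs (y - x) * Rabs (y - x))
      by (rewrite <- (pow2_abs (y - x)); ring).
    apply Rmult_le_compat_r; [apply Rabs_pos|].
    eapply Rle_trans; [apply B1|apply Rmult_le_compat_l; trivial].
    apply Rlt_le_trans with (2 := proj1 Hc). apply Rmin_glb_lt; lra.
Qed.

(** Termwise differentiation when the second-order remainders are summable uniformly
    near [x]. *)
Lemma is_derive_Series (phi : nat -> R -> R) (psi M : nat -> R) (x r : R) : 0 < r ->
  (forall n y, Rabs (y - x) < r ->
     Rabs (phi n y - phi n x - (y - x) * psi n) <= (y - x) ^ 2 * M n) ->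
  (forall y, Rabs (y - x) < r -> ex_series (fun n => phi n y)) ->
  ex_series psi -> ex_series M ->
  is_derive (fun y => Series (fun n => phi n y)) x (Series psi).
Proof.
  intros Hr H Hphi Hpsi HM. apply is_derive_Reals. intros eps Heps.
  set (K := Rabs (Series M) + 1).
  assert (HK : 0 < K) by (unfold K; generalize (Rabs_pos (Series M)); lra).
  assert (Hd : 0 < Rmin r (eps / K)) by (apply Rmin_pos; trivial; now apply Rdiv_lt_0_compat).
  exists (mkposreal _ Hd). intros h Hh0 Hh. simpl in Hh.
  assert (Hhr : Rabs h < r) by (eapply Rlt_le_trans; [apply Hh|apply Rmin_l]).
  assert (Hhe : Rabs h * K < eps).
  { apply Rlt_div_r; trivial. eapply Rlt_le_trans; [apply Hh|apply Rmin_r]. }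
  assert (E0 : ex_series (fun n => phi n x)).
  { apply Hphi. now rewrite Rminus_diag, Rabs_R0. }
  assert (E1 : ex_series (fun n => phi n (x + h))).
  { apply Hphi. now replace (x + h - x) with h by ring. }
  assert (B : Rabs (Series (fun n => phi n (x + h)) - Series (fun n => phi n x) - h * Series psi)
      <= h ^ 2 * Series M).
  { rewrite <- Series_minus, <- Series_scal_l, <- Series_minus, <- Series_scal_l; trivial.
    - apply Rle_trans with (Series (fun n => Rabs (phi n (x + h) - phi n x - h * psi n))).
      + apply Series_Rabs. apply (ex_series_dominated _ (fun n => h ^ 2 * M n)).
        * intro n. rewrite Rabs_Rabsolu. generalize (H n (x + h)).
          replace (x + h - x) with h by ring. auto.
        * now apply (ex_series_scal (h ^ 2) M).
      + apply Series_le.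
        * intro n. split; [apply Rabs_pos|]. generalize (H n (x + h)).
          replace (x + h - x) with h by ring. auto.
        * now apply (ex_series_scal (h ^ 2) M).
    - now apply (ex_series_minus (fun n => phi n (x + h))).
    - now apply (ex_series_scal h psi). }
  set (F1 := Series (fun n => phi n (x + h))) in *. set (F0 := Series (fun n => phi n x)) in *.
  replace ((F1 - F0) / h - Series psi) with ((F1 - F0 - h * Series psi) / h) by (field; trivial).
  unfold Rdiv. rewrite Rabs_mult, Rabs_inv.
  assert (Ha : 0 < Rabs h) by now apply Rabs_pos_lt.
  apply Rlt_div_l; trivial.
  eapply Rle_lt_trans; [apply B|]. rewrite <- (pow2_abs h).
  assert (Series M <= K) by (unfold K; generalize (Rle_abs (Series M)); lra).
  nra.
Qed.

(** * The operator C_d and the Dirichlet form *)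

(** [- deriv_sign (negb b)] is -1 for cosines and 1 for sines: C_d sends sin (n x) to
    - coth (n d) cos (n x) and cos (n x) to coth (n d) sin (n x). *)
Definition cop_coef (d : R) (u : R -> R) (b : bool) (n : nat) : R :=
  coth (INR (S n) * d) * (- deriv_sign (negb b) * coef (negb b) u (S n)).

Lemma Cop_trig_series d u : Cop d u = trig_series (cop_coef d u).
Proof.
  apply functional_extensionality. intro x. apply Series_ext. intro n.
  change (fourier_cos u (S n)) with (coef true u (S n)).
  change (fourier_sin u (S n)) with (coef false u (S n)).
  unfold trig_term, cop_coef. simpl deriv_sign. simpl negb. unfold trig. ring.
Qed.

Lemma coth_INR_bounds d n : 0 < d -> 1 <= coth (INR (S n) * d) <= 1 + / d.
Proof.
  intro Hd.
  assert (Hn : 1 <= INR (S n)) by (rewrite S_INR; generalize (pos_INR n); lra).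
  assert (Hnd : d <= INR (S n) * d) by nra.
  destruct (coth_bounds (INR (S n) * d)) as [H1 H2]; [lra|].
  assert (/ (INR (S n) * d) <= / d) by (apply Rinv_le_contravar; lra).
  lra.
Qed.

Lemma summable_cop_coef d u : 0 < d -> periodic_C1 u -> summable (cop_coef d u).
Proof.
  intros Hd Hu.
  apply (ex_series_dominated _ (fun n => (1 + / d) *
    (Rabs (coef true u (S n)) + Rabs (coef false u (S n))))).
  - intro n. destruct (coth_INR_bounds d n Hd) as [H1 H2].
    unfold cop_coef. simpl deriv_sign. simpl negb. rewrite !Rabs_mult.
    replace (Rabs (- (1))) with 1 by (rewrite Rabs_left; lra).
    replace (Rabs (- (-1))) with 1 by (rewrite Rabs_right; lra).
    rewrite (Rabs_right (coth _)) by lra.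
    rewrite Rabs_right.
    + generalize (Rabs_pos (coef true u (S n))) (Rabs_pos (coef false u (S n))). nra.
    + generalize (Rabs_pos (coef true u (S n))) (Rabs_pos (coef false u (S n))). nra.
  - apply (ex_series_scal (1 + / d) (fun n => Rabs (coef true u (S n)) + Rabs (coef false u (S n)))).
    exact (summable_coef u Hu).
Qed.

Lemma cont_Cop d u : 0 < d -> periodic_C1 u -> cont (Cop d u).
Proof. intros. rewrite Cop_trig_series. auto using cont_trig_series, summable_cop_coef. Qed.
#[local] Hint Resolve cont_Cop : cont.

Lemma periodic_Cop d u : periodic (Cop d u).
Proof. rewrite Cop_trig_series. apply periodic_trig_series. Qed.

Lemma integral_Cop d u : 0 < d -> periodic_C1 u -> integral (Cop d u) = 0.
Proof. intros. rewrite Cop_trig_series. auto using integral_trig_series, summable_cop_coef. Qed.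

Lemma coef_Cop d u b n : 0 < d -> periodic_C1 u -> coef b (Cop d u) (S n) = cop_coef d u b n.
Proof. intros. rewrite Cop_trig_series. auto using coef_trig_series, summable_cop_coef. Qed.

Lemma integral_mult_Cop d f u : 0 < d -> cont f -> periodic_C1 u ->
  is_series (fun n => PI * pairing (cop_coef d u) (fun b n => coef b f (S n)) n)
    (integral (fun x => f x * Cop d u x)).
Proof.
  intros. rewrite Cop_trig_series. auto using integral_mult_trig_series, summable_cop_coef.
Qed.

Lemma Cop_scal d c u x : cont u -> Cop d (fun y => c * u y) x = c * Cop d u x.
Proof.
  intro Hu. unfold Cop. rewrite <- Series_scal_l. apply Series_ext. intro n.
  change fourier_cos with (coef true). change fourier_sin with (coef false).
  rewrite !coef_scal by trivial. ring.
Qed.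

Lemma is_series_ext_R (a b : nat -> R) (l : R) :
  (forall n, a n = b n) -> is_series a l -> is_series b l.
Proof. apply is_series_ext. Qed.

Lemma is_series_minus_R (a b : nat -> R) (l m : R) :
  is_series a l -> is_series b m -> is_series (fun n => a n - b n) (l - m).
Proof. exact (is_series_minus a b l m). Qed.

(** For harmonic functions in the strip -d < y < 0 that vanish on the bottom and equal
    [f] and [u] on top, both of zero mean, this is the integral of the product of their
    gradients. *)
Definition energy (d : R) (f u : R -> R) : R :=
  integral (fun x => f x * Cop d (Derive u) x).

Definition gradient_pairing (f u : R -> R) : nat -> R :=
  pairing (fun b n => coef b (Derive f) (S n)) (fun b n => coef b (Derive u) (S n)).

(** Stated through the coefficients of [f'] and [u'], whose products are summable; the
    two derivatives leave a factor 1 / n^2 in front of n coth(n d). *)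
Lemma energy_is_series d f u : 0 < d -> periodic_C1 f -> periodic_C2 u ->
  is_series (fun n => PI * gradient_pairing f u n * (coth (INR (S n) * d) / INR (S n)))
    (energy d f u).
Proof.
  intros Hd Hf Hu.
  refine (is_series_ext_R _ _ _ _ (integral_mult_Cop d f (Derive u) Hd _ _)); auto with cont smooth.
  intro n. unfold pairing, gradient_pairing, pairing, cop_coef.
  rewrite !(coef_Derive _ f) by trivial. simpl deriv_sign. simpl negb.
  field. apply not_0_INR. lia.
Qed.

Lemma energy_sym d f u : 0 < d -> periodic_C2 f -> periodic_C2 u -> energy d f u = energy d u f.
Proof.
  intros Hd Hf Hu.
  rewrite <- (is_series_unique _ _ (energy_is_series d f u Hd ltac:(auto with smooth) Hu)).
  apply is_series_unique.
  refine (is_series_ext_R _ _ _ _ (energy_is_series d u f Hd ltac:(auto with smooth) Hf)).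
  intro n. unfold gradient_pairing, pairing. f_equal. f_equal. ring.
Qed.

Lemma energy_plus_l d f g u : 0 < d -> cont f -> cont g -> periodic_C2 u ->
  energy d (fun x => f x + g x) u = energy d f u + energy d g u.
Proof.
  intros. unfold energy. rewrite <- integral_plus by auto with cont smooth.
  apply integral_ext. intro; ring.
Qed.

Lemma energy_scal_l d c f u : 0 < d -> cont f -> periodic_C2 u ->
  energy d (fun x => c * f x) u = c * energy d f u.
Proof.
  intros. unfold energy. rewrite <- integral_scal by auto with cont smooth.
  apply integral_ext. intro; ring.
Qed.

Lemma energy_const_l d c u : 0 < d -> periodic_C2 u -> energy d (fun _ => c) u = 0.
Proof.
  intros. unfold energy. rewrite integral_scal, integral_Cop by auto with cont smooth. ring.
Qed.

Lemma energy_plus_r d f u v : 0 < d -> periodic_C2 f -> periodic_C2 u -> periodic_C2 v ->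
  energy d f (fun x => u x + v x) = energy d f u + energy d f v.
Proof.
  intros. rewrite !(energy_sym d f) by auto with smooth.
  apply energy_plus_l; auto with cont.
Qed.

Lemma energy_scal_r d c f u : 0 < d -> periodic_C2 f -> periodic_C2 u ->
  energy d f (fun x => c * u x) = c * energy d f u.
Proof.
  intros. rewrite !(energy_sym d f) by auto with smooth.
  apply energy_scal_l; auto with cont.
Qed.

Lemma ex_series_gradient_pairing f u : cont (Derive f) -> cont (Derive u) ->
  ex_series (fun n => Rabs (gradient_pairing f u n)).
Proof.
  intros Hf Hu.
  apply (ex_series_dominated _ (fun n => spectral_energy (Derive f) n + spectral_energy (Derive u) n)).
  - intro n. rewrite Rabs_Rabsolu. unfold gradient_pairing, pairing, spectral_energy. apply Rabs_le.
    set (a := coef true (Derive f) (S n)). set (b := coef false (Derive f) (S n)).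
    set (a' := coef true (Derive u) (S n)). set (b' := coef false (Derive u) (S n)).
    generalize (pow2_ge_0 (a + a')) (pow2_ge_0 (a - a')) (pow2_ge_0 (b + b')) (pow2_ge_0 (b - b'))
      (pow2_ge_0 a) (pow2_ge_0 a') (pow2_ge_0 b) (pow2_ge_0 b').
    intros. split; nra.
  - apply (ex_series_plus (spectral_energy (Derive f))); now apply ex_series_spectral_energy.
Qed.

Lemma integral_Derive f : periodic_C1 f -> integral (Derive f) = 0.
Proof.
  intro Hf. apply is_RInt_unique.
  destruct (Hf) as (P & D & H).
  replace 0 with (minus (f PI) (f (- PI))).
  - apply (is_RInt_derive f).
    + intros x _. apply Derive_correct, D.
    + intros x _. apply H.
  - rewrite <- (P (- PI)). replace (- PI + 2 * PI) with PI by ring. apply Rminus_diag.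
Qed.

(** The d-derivative of coth(n d) / n is 1 - coth(n d)^2.  Parseval's identity turns the
    part with 1 into the integral of f' u', and coth(n d)^2 is the multiplier of the
    pairing of C_d(f') with C_d(u'). *)
Lemma is_derive_energy d f u : 0 < d -> periodic_C2 f -> periodic_C2 u ->
  is_derive (fun d => energy d f u) d
    (integral (fun x => Derive f x * Derive u x)
     - integral (fun x => Cop d (Derive f) x * Cop d (Derive u) x)).
Proof.
  intros Hd Hf Hu.
  assert (Cf : cont (Derive f)) by auto with cont.
  assert (Cu : cont (Derive u)) by auto with cont.
  assert (Hn : forall n, 1 <= INR (S n)) by (intro; rewrite S_INR; generalize (pos_INR n); lra).
  assert (S1 := parseval (Derive f) (Derive u) Cf ltac:(auto with smooth)
    (integral_Derive u ltac:(auto with smooth))).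
  assert (S2 := integral_mult_Cop d (Cop d (Derive f)) (Derive u) Hd
    ltac:(auto with cont smooth) ltac:(auto with smooth)).
  assert (S3 := is_series_minus_R _ _ _ _ S1 S2).
  apply (is_series_ext_R _
    (fun n => PI * gradient_pairing f u n * (1 - coth (INR (S n) * d) ^ 2))) in S3.
  2:{ intro n.
      unfold gradient_pairing, pairing. rewrite !coef_Cop by auto with smooth.
      unfold cop_coef. simpl deriv_sign. simpl negb. ring. }
  rewrite <- (is_series_unique _ _ S3).
  apply (is_derive_ext_loc (fun d => Series (fun n => PI * gradient_pairing f u n
          * (coth (INR (S n) * d) / INR (S n))))).
  { generalize (open_gt 0 d Hd). apply filter_imp. intros y Hy.
    apply is_series_unique, energy_is_series; auto with smooth. }
  set (K := 2 * (1 + 2 / d) * (4 / d + 4 / d ^ 2)).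
  apply (is_derive_Series _ _ (fun n => PI * K * Rabs (gradient_pairing f u n)) d (d / 2));
    [lra| | | |].
  - intros n y Hy.
    assert (T := coth_scaled_taylor (INR (S n)) d y (Hn n) Hd Hy). fold K in T.
    match goal with |- Rabs ?e <= _ => replace e with
      (PI * gradient_pairing f u n
       * (coth (INR (S n) * y) / INR (S n) - coth (INR (S n) * d) / INR (S n)
         - (y - d) * (1 - coth (INR (S n) * d) ^ 2))) by ring end.
    rewrite !Rabs_mult, (Rabs_right PI) by (generalize PI_RGT_0; lra).
    replace ((y - d) ^ 2 * (PI * K * Rabs (gradient_pairing f u n)))
      with (PI * Rabs (gradient_pairing f u n) * ((y - d) ^ 2 * K)) by ring.
    apply Rmult_le_compat_l; trivial.
    apply Rmult_le_pos; [generalize PI_RGT_0; lra|apply Rabs_pos].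
  - intros y Hy. eexists. apply energy_is_series; auto with smooth.
    apply Rabs_lt_between in Hy. lra.
  - eexists. apply S3.
  - apply (ex_series_scal (PI * K) (fun n => Rabs (gradient_pairing f u n))).
    now apply ex_series_gradient_pairing.
Qed.

(** * Regularity of the unknown and of the test functions *)

Lemma periodic_Derive f : periodic f -> periodic (Derive f).
Proof.
  intros P x. unfold Derive. f_equal. apply Lim_ext. intro y.
  replace (x + 2 * PI + y) with (x + y + 2 * PI) by ring. now rewrite !P.
Qed.

Lemma Hoelder_cont (alpha M : R) (f : R -> R) : 0 < alpha ->
  (forall x y, x <> y -> Rabs (f x - f y) <= M * Rpower (Rabs (x - y)) alpha) -> cont f.
Proof.
  intros Ha H x. apply filterlim_locally. intros eps.
  set (K := Rabs M + 1).
  assert (HK : 0 < K) by (unfold K; generalize (Rabs_pos M); lra).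
  assert (He := cond_pos eps).
  assert (Hd : 0 < Rpower (eps / K) (/ alpha)) by apply exp_pos.
  exists (mkposreal _ Hd). intros y Hy.
  change (Rabs (y - x) < Rpower (eps / K) (/ alpha)) in Hy.
  change (Rabs (f y - f x) < eps).
  destruct (Req_dec y x) as [->|Hne].
  { rewrite Rminus_diag, Rabs_R0. apply He. }
  assert (Hp : 0 < Rabs (y - x)) by (apply Rabs_pos_lt; lra).
  assert (HR : Rpower (Rabs (y - x)) alpha < eps / K).
  { replace (eps / K) with (Rpower (Rpower (eps / K) (/ alpha)) alpha).
    - unfold Rpower at 1 2. apply exp_increasing, Rmult_lt_compat_l; trivial.
      now apply ln_increasing.
    - rewrite Rpower_mult, Rinv_l, Rpower_1; trivial; [now apply Rdiv_lt_0_compat|lra]. }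
  eapply Rle_lt_trans; [now apply H|].
  assert (0 < Rpower (Rabs (y - x)) alpha) by apply exp_pos.
  apply Rlt_div_r in HR; trivial.
  assert (M <= K) by (unfold K; generalize (Rle_abs M); lra).
  nra.
Qed.

Lemma periodic_C2_of_Hoelder alpha w : 0 < alpha -> C2_periodic alpha w -> periodic_C2 w.
Proof.
  intros Ha (P & D & M & HM).
  split; trivial. split; [exact (fun x => D 1%nat x ltac:(lia))|].
  split; [now apply periodic_Derive|].
  split; [exact (fun x => D 2%nat x ltac:(lia))|].
  exact (Hoelder_cont alpha M _ Ha HM).
Qed.

Lemma smooth_periodic_trig b n : smooth_periodic (trig b n).
Proof.
  split; [apply periodic_trig|].
  assert (H : forall j, exists c b', forall x, Derive_n (trig b n) j x = c * trig b' n x).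
  { induction j as [|j (c & b' & H)].
    - exists 1, b. intro x. simpl. ring.
    - exists (c * (deriv_sign b' * INR n)), (negb b'). intro x. simpl.
      rewrite (Derive_ext _ _ _ H), Derive_scal, Derive_trig. ring. }
  intros [|j] x; [exact I|].
  destruct (H j) as (c & b' & Hj).
  apply (ex_derive_ext (fun y => c * trig b' n y)); [intro; now rewrite Hj|].
  apply (ex_derive_scal (trig b' n)). eexists. apply is_derive_trig.
Qed.

(** * Lambda as a polynomial functional *)

Definition flux (g Upsilon Q : R) (v : R -> R) (x : R) : R :=
  Q * v x - g * v x ^ 2 - Upsilon ^ 2 / 3 * v x ^ 3.

Definition dflux (g Upsilon Q : R) (v : R -> R) (x : R) : R :=
  Q - 2 * g * v x - Upsilon ^ 2 * v x ^ 2.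

(** The depth [d] is an argument of its own, since a change of h acts on v = w + h and on
    d = k h in different ways. *)
Definition reduced_Lambda (g k Upsilon m Q d : R) (v : R -> R) : R :=
  1 / k * integral (flux g Upsilon Q v) + energy d (flux g Upsilon Q v) v
  + 2 * PI / d * (m - Upsilon / 2 * mean (fun x => v x ^ 2)) ^ 2
  + Upsilon ^ 2 / 4 * energy d (fun x => v x ^ 2) (fun x => v x ^ 2).

Lemma periodic_C2_flux g U Q v : periodic_C2 v -> periodic_C2 (flux g U Q v).
Proof. intro. unfold flux. auto 8 with smooth. Qed.
Lemma periodic_C2_dflux g U Q v : periodic_C2 v -> periodic_C2 (dflux g U Q v).
Proof. intro. unfold dflux. auto 8 with smooth. Qed.
#[local] Hint Resolve periodic_C2_flux periodic_C2_dflux : smooth.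

Lemma Derive_sqr v : periodic_C2 v -> Derive (fun x => v x ^ 2) = fun x => 2 * (v x * Derive v x).
Proof.
  intros (_ & D & _). apply functional_extensionality. intro x.
  apply is_derive_unique. auto_derive; auto. change (fun x => v x) with v. ring.
Qed.

Lemma Derive_flux g U Q v : periodic_C2 v ->
  Derive (flux g U Q v) = fun x => dflux g U Q v x * Derive v x.
Proof.
  intros (_ & D & _). apply functional_extensionality. intro x.
  apply is_derive_unique. unfold flux, dflux. auto_derive; auto.
  change (fun x => v x) with v. field.
Qed.

Lemma Cop_mult_Derive d v x : periodic_C2 v ->
  Cop d (fun y => v y * Derive v y) x = / 2 * Cop d (Derive (fun y => v y ^ 2)) x.
Proof.
  intro Hv. rewrite <- Cop_scal.
  - f_equal. apply functional_extensionality. intro y. rewrite Derive_sqr by trivial. field.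
  - apply periodic_C2_cont_Derive. auto with smooth.
Qed.

Lemma periodic_C1_mult_Derive v : periodic_C2 v -> periodic_C1 (fun y => v y * Derive v y).
Proof. intro. apply periodic_C1_mult; auto with smooth. Qed.
#[local] Hint Resolve periodic_C1_mult_Derive : smooth.

Lemma periodic_C1_dflux_Derive g U Q v : periodic_C2 v ->
  periodic_C1 (fun y => dflux g U Q v y * Derive v y).
Proof. intro. apply periodic_C1_mult; auto with smooth. Qed.
#[local] Hint Resolve periodic_C1_dflux_Derive : smooth.

#[local] Hint Extern 2 (cont _) => (apply periodic_C1_cont; solve [auto with smooth]) : cont.

Lemma Lambda_reduced g k U m Q w h : 0 < k -> 0 < h -> periodic_C2 (fun x => w x + h) ->
  Lambda g k U m Q w h = reduced_Lambda g k U m Q (k * h) (fun x => w x + h).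
Proof.
  intros Hk Hh Hv. unfold Lambda. set (v := fun x => w x + h) in *. cbv zeta.
  assert (Hd : 0 < k * h) by now apply Rmult_lt_0_compat.
  set (mu := mean (fun y => v y ^ 2)).
  set (A := m / (k * h) - U / (2 * k * h) * mu).
  set (C := Cop (k * h) (fun y => v y * Derive v y)).
  assert (HC : cont C) by (unfold C; auto with cont smooth).
  assert (HV : cont v) by auto with cont.
  change (integral (fun x => flux g U Q v x * (1 / k + Cop (k * h) (Derive v) x))
    + integral (fun x => (m - U / 2 * v x ^ 2) * (A - U * C x))
    = reduced_Lambda g k U m Q (k * h) v).
  rewrite (integral_ext _ (fun x => 1 / k * flux g U Q v x
     + flux g U Q v x * Cop (k * h) (Derive v) x)) by (intro; ring).
  rewrite integral_plus, integral_scal by auto with cont smooth.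
  rewrite (integral_ext (fun x => (m - U / 2 * v x ^ 2) * (A - U * C x))
    (fun x => A * m - A * U / 2 * v x ^ 2 - m * U * C x + U ^ 2 / 2 * (v x ^ 2 * C x)))
    by (intro; field).
  rewrite integral_plus, !integral_minus, !integral_scal by auto 6 with cont.
  rewrite integral_const.
  assert (HC0 : integral C = 0) by (unfold C; auto using integral_Cop with smooth).
  rewrite HC0, (integral_mean (fun x => v x ^ 2)). fold mu.
  unfold reduced_Lambda. fold mu.
  assert (HE : energy (k * h) (fun x => v x ^ 2) (fun x => v x ^ 2)
    = 2 * integral (fun x => v x ^ 2 * C x)).
  { unfold energy. rewrite <- integral_scal by auto with cont.
    apply integral_ext. intro x. unfold C. rewrite Cop_mult_Derive by trivial. field. }
  rewrite HE. unfold energy, A. field. lra.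
Qed.

(** The first variation of [reduced_Lambda] at [v] in the direction [phi]. *)
Definition variation (g k Upsilon m Q d : R) (v phi : R -> R) : R :=
  1 / k * integral (fun x => dflux g Upsilon Q v x * phi x)
  + energy d (fun x => dflux g Upsilon Q v x * phi x) v
  + energy d (flux g Upsilon Q v) phi
  - 4 * PI / d * (m - Upsilon / 2 * mean (fun x => v x ^ 2))
      * (Upsilon * mean (fun x => v x * phi x))
  + Upsilon ^ 2 * energy d (fun x => v x * phi x) (fun x => v x ^ 2).

Lemma ex_derive_energy d f u : 0 < d -> periodic_C2 f -> periodic_C2 u ->
  ex_derive (fun d => energy d f u) d.
Proof. intros. eexists. now apply is_derive_energy. Qed.

Lemma ex_derive_add (f g : R -> R) x : ex_derive f x -> ex_derive g x ->
  ex_derive (fun y => f y + g y) x.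
Proof. exact (ex_derive_plus f g x). Qed.

Lemma ex_derive_sub (f g : R -> R) x : ex_derive f x -> ex_derive g x ->
  ex_derive (fun y => f y - g y) x.
Proof. exact (ex_derive_minus f g x). Qed.

Lemma ex_derive_prod (f g : R -> R) x : ex_derive f x -> ex_derive g x ->
  ex_derive (fun y => f y * g y) x.
Proof. exact (ex_derive_mult f g x). Qed.

Lemma ex_derive_const_R (c x : R) : ex_derive (fun _ => c) x.
Proof. apply ex_derive_const. Qed.

Lemma ex_derive_const_div (c x : R) : x <> 0 -> ex_derive (fun y => c / y) x.
Proof. intro Hx. auto_derive. exact Hx. Qed.

Create HintDb deriv.
#[local] Hint Resolve ex_derive_energy ex_derive_add ex_derive_sub ex_derive_prod
  ex_derive_const_R ex_derive_const_div : deriv.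

(** The coefficients beyond the first order enter only as differentiable functions of
    [d]: their factors eps^2, eps^3, eps^4 vanish to second order when [eps] is the
    change of height. *)
Lemma reduced_Lambda_expansion g k U m Q v phi : periodic_C2 v -> periodic_C2 phi ->
  exists L2 L3 L4 : R -> R,
  (forall d, 0 < d -> ex_derive L2 d /\ ex_derive L3 d /\ ex_derive L4 d) /\
  forall d eps, 0 < d ->
    reduced_Lambda g k U m Q d (fun x => v x + eps * phi x)
    = reduced_Lambda g k U m Q d v + eps * variation g k U m Q d v phi
      + eps ^ 2 * L2 d + eps ^ 3 * L3 d + eps ^ 4 * L4 d.
Proof.
  intros Hv Hphi.
  set (F0 := flux g U Q v).
  set (F1 := fun x => dflux g U Q v x * phi x).
  set (F2 := fun x => (- g - U ^ 2 * v x) * phi x ^ 2).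
  set (F3 := fun x => - U ^ 2 / 3 * phi x ^ 3).
  set (S0 := fun x => v x ^ 2).
  set (S1 := fun x => v x * phi x).
  set (S2 := fun x => phi x ^ 2).
  assert (HF0 : periodic_C2 F0) by (unfold F0; auto with smooth).
  assert (HF1 : periodic_C2 F1) by (unfold F1; auto with smooth).
  assert (HF2 : periodic_C2 F2) by (unfold F2; auto 6 with smooth).
  assert (HF3 : periodic_C2 F3) by (unfold F3; auto 6 with smooth).
  assert (HS0 : periodic_C2 S0) by (unfold S0; auto with smooth).
  assert (HS1 : periodic_C2 S1) by (unfold S1; auto with smooth).
  assert (HS2 : periodic_C2 S2) by (unfold S2; auto with smooth).
  set (c0 := m - U / 2 * mean S0). set (c1 := - U * mean S1). set (c2 := - U / 2 * mean S2).
  exists (fun d => 1 / k * integral F2 + energy d F2 v + energy d F1 phi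
     + 2 * PI / d * (c1 ^ 2 + 2 * c0 * c2)
     + U ^ 2 / 4 * (2 * energy d S0 S2 + 4 * energy d S1 S1)).
  exists (fun d => 1 / k * integral F3 + energy d F3 v + energy d F2 phi
     + 2 * PI / d * (2 * c1 * c2) + U ^ 2 * energy d S1 S2).
  exists (fun d => energy d F3 phi + 2 * PI / d * c2 ^ 2 + U ^ 2 / 4 * energy d S2 S2).
  split.
  - intros d Hd. assert (d <> 0) by lra. auto 20 with deriv.
  - intros d eps Hd.
    unfold reduced_Lambda.
    replace (flux g U Q (fun x => v x + eps * phi x))
      with (fun x => F0 x + eps * F1 x + eps ^ 2 * F2 x + eps ^ 3 * F3 x)
      by (apply functional_extensionality; intro; unfold F0, F1, F2, F3, flux, dflux; field).
    replace (fun x => (v x + eps * phi x) ^ 2)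
      with (fun x => S0 x + 2 * eps * S1 x + eps ^ 2 * S2 x)
      by (apply functional_extensionality; intro; unfold S0, S1, S2; ring).
    rewrite !integral_plus, !integral_scal by auto 9 with cont.
    rewrite !energy_plus_r, !energy_scal_r by auto 9 with smooth.
    rewrite !energy_plus_l, !energy_scal_l by auto 9 with cont smooth.
    rewrite (energy_sym d S1 S0), (energy_sym d S2 S0), (energy_sym d S2 S1) by trivial.
    replace (mean (fun x => S0 x + 2 * eps * S1 x + eps ^ 2 * S2 x))
      with (mean S0 + 2 * eps * mean S1 + eps ^ 2 * mean S2).
    2:{ rewrite !mean_integral, !integral_plus, !integral_scal by auto 9 with cont. ring. }
    fold F0 S0. unfold variation. fold F0 F1 S0 S1. fold c0.
    rewrite (energy_sym d S1 S0) by trivial.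
    replace (m - U / 2 * (mean S0 + 2 * eps * mean S1 + eps ^ 2 * mean S2))
      with (c0 + eps * c1 + eps ^ 2 * c2) by (unfold c0, c1, c2; field).
    replace (U * mean S1) with (- c1) by (unfold c1; ring).
    set (ik := 1 / k). field. lra.
Qed.

(** * The Euler equation *)

(** The y-derivative on top of the strip -kh < y < 0 of the harmonic function that equals
    m - Upsilon v^2 / 2 on top and 0 on the bottom. *)
Definition stream_slope (k h Upsilon m : R) (v : R -> R) (x : R) : R :=
  m / (k * h) - Upsilon / (2 * k * h) * mean (fun y => v y ^ 2)
  - Upsilon * Cop (k * h) (fun y => v y * Derive v y) x.

Definition euler (g k Upsilon m Q h : R) (v : R -> R) (x : R) : R :=
  Cop (k * h) (fun y => dflux g Upsilon Q v y * Derive v y) x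
  + dflux g Upsilon Q v x * (1 / k + Cop (k * h) (Derive v) x)
  - 2 * Upsilon * v x * stream_slope k h Upsilon m v x.

Lemma cont_stream_slope k h U m v : 0 < k * h -> periodic_C2 v -> cont (stream_slope k h U m v).
Proof. intros. unfold stream_slope. auto 6 with cont smooth. Qed.
#[local] Hint Resolve cont_stream_slope : cont.

Lemma cont_euler g k U m Q h v : 0 < k * h -> periodic_C2 v -> cont (euler g k U m Q h v).
Proof. intros. unfold euler. auto 7 with cont smooth. Qed.
#[local] Hint Resolve cont_euler : cont.

Lemma periodic_euler g k U m Q h v : periodic_C2 v -> periodic (euler g k U m Q h v).
Proof.
  intros Hv x. unfold euler, stream_slope, dflux. rewrite !periodic_Cop.
  now rewrite (proj1 Hv).
Qed.

(** Symmetry of [energy] frees [phi] from C_d in the term [energy d (flux v) phi]; the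
    other terms already have [phi] as a factor of the integrand. *)
Lemma variation_euler g k U m Q h v phi : 0 < k -> 0 < h -> periodic_C2 v -> periodic_C2 phi ->
  variation g k U m Q (k * h) v phi = integral (fun x => phi x * euler g k U m Q h v x).
Proof.
  intros Hk Hh Hv Hphi.
  assert (Hd : 0 < k * h) by now apply Rmult_lt_0_compat.
  unfold variation.
  rewrite (energy_sym _ (flux g U Q v)) by auto with smooth.
  unfold energy. rewrite Derive_flux by trivial.
  set (p := dflux g U Q v).
  set (G := Cop (k * h) (Derive v)).
  set (X := Cop (k * h) (fun x => p x * Derive v x)).
  set (Y := Cop (k * h) (fun y => v y * Derive v y)).
  set (mu := mean (fun x => v x ^ 2)).
  assert (Hp : cont p) by (unfold p; auto with cont smooth).
  assert (HG : cont G) by (unfold G; auto with cont smooth).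
  assert (HX : cont X) by (unfold X, p; auto with cont smooth).
  assert (HY : cont Y) by (unfold Y; auto with cont smooth).
  assert (HV : cont v) by auto with cont.
  assert (HP : cont phi) by auto with cont.
  rewrite (integral_ext (fun x => v x * phi x * Cop (k * h) (Derive (fun y => v y ^ 2)) x)
     (fun x => 2 * (v x * phi x * Y x))).
  2:{ intro x. unfold Y. rewrite Cop_mult_Derive by trivial. field. }
  set (A := m / (k * h) - U / (2 * k * h) * mu).
  rewrite (integral_ext (fun x => phi x * euler g k U m Q h v x)
    (fun x => 1 / k * (p x * phi x) + p x * phi x * G x + phi x * X x
       + (-2 * U * A) * (v x * phi x) + U ^ 2 * (2 * (v x * phi x * Y x)))).
  2:{ intro x. unfold euler, stream_slope. fold p mu X Y G A.
      change (Cop (k * h) (fun y => dflux g U Q v y * Derive v y) x) with (X x). ring. }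
  rewrite !integral_plus, !integral_scal by auto 9 with cont.
  rewrite (mean_integral (fun x => v x * phi x)). unfold A. field.
  repeat split; try lra. apply PI_neq0.
Qed.

(** Testing with 1, on which [energy] vanishes.  What remains is a combination of
    [energy v v] and [energy (v^2) v]; the latter cancels against [energy v (v^2)]. *)
Lemma integral_euler g k U m Q h v : 0 < k -> 0 < h -> periodic_C2 v -> mean v = h ->
  integral (euler g k U m Q h v)
  = 2 * PI * ((Q - 2 * U * m - 2 * g * h) / k
              - 2 * g * mean (fun x => v x * Cop (k * h) (Derive v) x)).
Proof.
  intros Hk Hh Hv Hm.
  assert (Hd : 0 < k * h) by now apply Rmult_lt_0_compat.
  assert (H := variation_euler g k U m Q h v (fun _ => 1) Hk Hh Hv (periodic_C2_const 1)).
  rewrite (integral_ext _ (euler g k U m Q h v)) in H by (intro; ring).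
  rewrite <- H. unfold variation.
  rewrite (energy_sym _ (flux g U Q v)), energy_const_l by auto with smooth.
  replace (fun x => v x * 1) with v by (apply functional_extensionality; intro; ring).
  replace (fun x => dflux g U Q v x * 1)
    with (fun x => Q + (-2 * g) * v x + (- U ^ 2) * v x ^ 2)
    by (apply functional_extensionality; intro; unfold dflux; ring).
  rewrite !integral_plus, !integral_scal, integral_const, (integral_mean v),
    (integral_mean (fun x => v x ^ 2)) by auto 9 with cont.
  rewrite !energy_plus_l, !energy_scal_l, energy_const_l by auto 9 with cont smooth.
  rewrite (energy_sym _ v (fun x => v x ^ 2)) by auto with smooth.
  rewrite Hm. unfold energy. rewrite (integral_mean (fun x => v x * _)).
  field. lra.
Qed.

Lemma is_derive_eq_value (f : R -> R) (x l l' : R) :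
  is_derive f x l -> l = l' -> is_derive f x l'.
Proof. now intros H <-. Qed.

Lemma is_derive_combination (e1 e2 : R -> R) (a b c q x l1 l2 : R) : x <> 0 ->
  is_derive e1 x l1 -> is_derive e2 x l2 ->
  is_derive (fun y => a + e1 y + b / y * c + q * e2 y) x (l1 - b / x ^ 2 * c + q * l2).
Proof.
  intros Hx H1 H2.
  assert (E1 := is_derive_unique _ _ _ H1). assert (E2 := is_derive_unique _ _ _ H2).
  auto_derive.
  - repeat split; trivial; eexists; eassumption.
  - change (fun x => e1 x) with e1. change (fun x => e2 x) with e2.
    rewrite E1, E2. field. exact Hx.
Qed.

Lemma is_derive_reduced_Lambda g k U m Q d v : 0 < d -> periodic_C2 v ->
  is_derive (fun d : R => reduced_Lambda g k U m Q d v) d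
    (integral (fun x => dflux g U Q v x * Derive v x ^ 2)
     - integral (fun x => Cop d (fun y => dflux g U Q v y * Derive v y) x * Cop d (Derive v) x)
     - 2 * PI / d ^ 2 * (m - U / 2 * mean (fun x => v x ^ 2)) ^ 2
     + U ^ 2 * (integral (fun x => v x ^ 2 * Derive v x ^ 2)
                - integral (fun x => Cop d (fun y => v y * Derive v y) x ^ 2))).
Proof.
  intros Hd Hv.
  assert (H1 := is_derive_energy d (flux g U Q v) v Hd ltac:(auto with smooth) Hv).
  assert (H2 := is_derive_energy d (fun x => v x ^ 2) (fun x => v x ^ 2) Hd
    ltac:(auto with smooth) ltac:(auto with smooth)).
  rewrite Derive_flux in H1 by trivial.
  eapply is_derive_eq_value;
    [exact (is_derive_combination _ _ _ _ _ _ d _ _ ltac:(lra) H1 H2)|].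
    rewrite (integral_ext (fun x => dflux g U Q v x * Derive v x * Derive v x)
      (fun x => dflux g U Q v x * Derive v x ^ 2)) by (intro; ring).
    rewrite (integral_ext (fun x => Derive (fun x0 => v x0 ^ 2) x * Derive (fun x0 => v x0 ^ 2) x)
      (fun x => 4 * (v x ^ 2 * Derive v x ^ 2))).
    2:{ intro x. rewrite Derive_sqr by trivial. ring. }
    rewrite (integral_ext (fun x => Cop d (Derive (fun x0 => v x0 ^ 2)) x
                                 * Cop d (Derive (fun x0 => v x0 ^ 2)) x)
      (fun x => 4 * Cop d (fun y => v y * Derive v y) x ^ 2)).
    2:{ intro x. rewrite Cop_mult_Derive by trivial. field. }
    rewrite !integral_scal by auto 7 with cont smooth.
    field. lra.
Qed.

Lemma euler_const g k U m Q h v : 0 < k -> 0 < h -> periodic_C2 v ->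
  (forall b n, variation g k U m Q (k * h) v (trig b (S n)) = 0) ->
  forall x, euler g k U m Q h v x = mean (euler g k U m Q h v).
Proof.
  intros Hk Hh Hv H x.
  assert (Hd : 0 < k * h) by now apply Rmult_lt_0_compat.
  set (E := euler g k U m Q h v).
  assert (HE : cont E) by (unfold E; auto with cont).
  apply Rminus_diag_uniq.
  apply (trig_complete (fun x => E x - mean E)).
  - auto with cont.
  - intro y. unfold E. now rewrite periodic_euler.
  - rewrite integral_minus, integral_const, integral_mean by auto with cont. ring.
  - intros b n.
    rewrite (coef_ext _ _ (fun x => E x - mean E * 1)) by (intro; ring).
    rewrite coef_minus, coef_scal, coef_one by auto with cont.
    specialize (H b n). rewrite variation_euler in H by auto with smooth.
    unfold coef. rewrite (integral_ext _ (fun x => trig b (S n) x * E x)) by (intro; ring).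
    unfold E. rewrite H. ring.
Qed.

(** * Critical points *)

Lemma is_lim_quotient_polynomial (a b c e : R) :
  is_lim (fun t => / t * (t * a + t ^ 2 * b + t ^ 3 * c + t ^ 4 * e)) 0 a.
Proof.
  apply (is_lim_ext_loc (fun t => a + t * b + t ^ 2 * c + t ^ 3 * e)).
  - exists (mkposreal 1 Rlt_0_1). intros t _ Ht. field. trivial.
  - set (f := fun t => a + t * b + t ^ 2 * c + t ^ 3 * e).
    assert (L : is_lim f 0 (f 0)).
    { apply is_lim_continuity, continuity_pt_filterlim.
      apply (ex_derive_continuous f). unfold f. auto_derive. trivial. }
    replace (f 0) with a in L by (unfold f; ring). exact L.
Qed.

Lemma critical_variation g k U m Q alpha w h phi : 0 < k -> 0 < alpha ->
  critical_point g k U m Q alpha w h -> smooth_periodic phi -> periodic_C2 phi -> mean phi = 0 ->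
  variation g k U m Q (k * h) (fun x => w x + h) phi = 0.
Proof.
  intros Hk Ha ((Hh & HC2 & _) & Hcrit & _) Hs Hphi H0.
  assert (Hw := periodic_C2_of_Hoelder alpha w Ha HC2).
  set (v := fun x => w x + h). assert (Hv : periodic_C2 v) by (unfold v; auto with smooth).
  assert (Hd : 0 < k * h) by now apply Rmult_lt_0_compat.
  destruct (reduced_Lambda_expansion g k U m Q v phi Hv Hphi) as (L2 & L3 & L4 & _ & E).
  specialize (Hcrit phi Hs H0).
  assert (L := is_lim_quotient_polynomial (variation g k U m Q (k * h) v phi)
     (L2 (k * h)) (L3 (k * h)) (L4 (k * h))).
  apply (is_lim_ext _ (fun eps =>
    / eps * (Lambda g k U m Q (fun x => w x + eps * phi x) h - Lambda g k U m Q w h))) in L.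
  - apply is_lim_unique in L. apply is_lim_unique in Hcrit.
    rewrite L in Hcrit. now injection Hcrit.
  - intro eps. f_equal.
    assert (Ev : (fun x => w x + eps * phi x + h) = (fun x => v x + eps * phi x))
      by (apply functional_extensionality; intro; unfold v; ring).
    rewrite !Lambda_reduced; trivial.
    + rewrite Ev. fold v. rewrite E by trivial. ring.
    + rewrite Ev. auto with smooth.
Qed.

Lemma ex_derive_variation g k U m Q d v phi : 0 < d -> periodic_C2 v -> periodic_C2 phi ->
  ex_derive (fun d => variation g k U m Q d v phi) d.
Proof.
  intros Hd Hv Hphi. assert (d <> 0) by lra. unfold variation.
  auto 20 with deriv smooth.
Qed.

(** For w + t = (w + h) + (t - h) the expansion in the direction 1 applies with
    eps = t - h and d = k t, and only its terms of order 0 and 1 in eps contribute to the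
    derivative at t = h. *)
Lemma critical_height g k U m Q alpha w h : 0 < k -> 0 < alpha ->
  critical_point g k U m Q alpha w h ->
  k * Derive (fun d => reduced_Lambda g k U m Q d (fun x => w x + h)) (k * h)
  + variation g k U m Q (k * h) (fun x => w x + h) (fun _ => 1) = 0.
Proof.
  intros Hk Ha ((Hh & HC2 & _) & _ & Hcrit).
  assert (Hw := periodic_C2_of_Hoelder alpha w Ha HC2).
  set (v := fun x => w x + h). assert (Hv : periodic_C2 v) by (unfold v; auto with smooth).
  assert (Hd : 0 < k * h) by now apply Rmult_lt_0_compat.
  destruct (reduced_Lambda_expansion g k U m Q v (fun _ => 1) Hv (periodic_C2_const 1))
    as (L2 & L3 & L4 & DL & E).
  destruct (DL (k * h) Hd) as (D2 & D3 & D4).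
  set (L0 := fun d => reduced_Lambda g k U m Q d v).
  set (L1 := fun d => variation g k U m Q d v (fun _ => 1)).
  assert (D0 : ex_derive L0 (k * h))
    by (eexists; exact (is_derive_reduced_Lambda g k U m Q (k * h) v Hd Hv)).
  assert (D1 : ex_derive L1 (k * h)).
  { exact (ex_derive_variation g k U m Q (k * h) v _ Hd Hv (periodic_C2_const 1)). }
  assert (H : is_derive (fun t => L0 (k * t) + (t - h) * L1 (k * t) + (t - h) ^ 2 * L2 (k * t)
     + (t - h) ^ 3 * L3 (k * t) + (t - h) ^ 4 * L4 (k * t)) h
     (k * Derive L0 (k * h) + L1 (k * h))).
  { auto_derive; [repeat match goal with |- _ /\ _ => split end; trivial|].
    change (fun x => L0 x) with L0. replace (h + - h) with 0 by ring. ring. }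
  apply (is_derive_ext_loc _ (fun t => Lambda g k U m Q w t)) in H.
  - apply is_derive_unique in H. apply is_derive_unique in Hcrit.
    fold L0 (L1 (k * h)). rewrite <- H. exact Hcrit.
  - generalize (open_gt 0 h Hh). apply filter_imp. intros t Ht.
    assert (Ev : (fun x => w x + t) = (fun x => v x + (t - h) * 1))
      by (apply functional_extensionality; intro; unfold v; ring).
    rewrite Lambda_reduced; trivial; [|auto with smooth].
    rewrite Ev, E by now apply Rmult_lt_0_compat. reflexivity.
Qed.

(** Write G = 1 / k + C_d(v'), B for the stream slope, p for [dflux v], X for C_d(p v')
    and e for the constant value of [euler].  Then X = e - p G + 2 Upsilon v B pointwise,
    and expanding the squares in the constraint produces, up to terms of zero integral,
    minus the integrand of the height derivative divided by k. *)
Lemma critical_constraint g k U m Q h v : 0 < k -> 0 < h -> periodic_C2 v ->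
  (forall x, euler g k U m Q h v x = mean (euler g k U m Q h v)) ->
  k * Derive (fun d => reduced_Lambda g k U m Q d v) (k * h)
  + variation g k U m Q (k * h) v (fun _ => 1) = 0 ->
  mean (fun x => (stream_slope k h U m v x
                  + U * v x * (1 / k + Cop (k * h) (Derive v) x)) ^ 2)
  = mean (fun x => (Q - 2 * g * v x)
                   * (Derive v x ^ 2 + (1 / k + Cop (k * h) (Derive v) x) ^ 2)).
Proof.
  intros Hk Hh Hv He H.
  assert (Hd : 0 < k * h) by now apply Rmult_lt_0_compat.
  rewrite variation_euler in H by auto with smooth.
  rewrite (integral_ext _ (euler g k U m Q h v)) in H by (intro; ring).
  rewrite integral_mean in H.
  set (e := mean (euler g k U m Q h v)) in *.
  rewrite (is_derive_unique _ _ _ (is_derive_reduced_Lambda g k U m Q (k * h) v Hd Hv)) in H.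
  assert (HX0 : integral (Cop (k * h) (fun y => dflux g U Q v y * Derive v y)) = 0)
    by auto using integral_Cop with smooth.
  assert (HY0 : integral (Cop (k * h) (fun y => v y * Derive v y)) = 0)
    by auto using integral_Cop with smooth.
  assert (HG0 : integral (Cop (k * h) (Derive v)) = 0)
    by auto using integral_Cop with smooth.
  assert (HX : cont (Cop (k * h) (fun y => dflux g U Q v y * Derive v y)))
    by auto with cont smooth.
  assert (HY : cont (Cop (k * h) (fun y => v y * Derive v y))) by auto with cont smooth.
  assert (HG : cont (Cop (k * h) (Derive v))) by auto with cont smooth.
  assert (Hv0 : cont v) by auto with cont.
  assert (Hv1 : cont (Derive v)) by auto with cont.
  assert (Hp : cont (dflux g U Q v)) by auto with cont smooth.
  unfold euler in He. unfold stream_slope in *.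
  set (p := dflux g U Q v) in *.
  set (X := Cop (k * h) (fun y => p y * Derive v y)) in *.
  set (Y := Cop (k * h) (fun y => v y * Derive v y)) in *.
  set (G := Cop (k * h) (Derive v)) in *.
  set (mu := mean (fun x => v x ^ 2)) in *.
  set (A := m / (k * h) - U / (2 * k * h) * mu) in *.
  assert (HA : k * (2 * PI / (k * h) ^ 2 * (m - U / 2 * mu) ^ 2) = 2 * PI * k * A ^ 2)
    by (unfold A; field; lra).
  apply Rminus_diag_uniq. rewrite !mean_integral, <- Rmult_minus_distr_l.
  rewrite <- integral_minus by auto 9 with cont.
  (* The last three terms have zero integral; the others sum to minus the integrand of
     H divided by k. *)
  rewrite (integral_ext _ (fun x =>
    - (1) * (p x * Derive v x ^ 2) + X x * G x + A ^ 2 + - U ^ 2 * (v x ^ 2 * Derive v x ^ 2)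
    + U ^ 2 * (Y x ^ 2) + - (e / k) + -2 * A * U * Y x + / k * X x + - e * G x)).
  - rewrite !integral_plus, !integral_scal, !integral_const, HX0, HY0, HG0 by auto 12 with cont.
    apply Rmult_eq_reg_l with (- (2 * PI) * k).
    2:{ generalize PI_RGT_0. nra. }
    rewrite !Rmult_plus_distr_l, !Rmult_minus_distr_l, HA in H.
    rewrite (Rmult_0_r (- (2 * PI) * k)). etransitivity; [|exact H]. field.
    split; [lra|apply PI_neq0].
  - intro x. specialize (He x). fold A in He. change (p x) with (dflux g U Q v x) in *.
    assert (HXx : X x = e - dflux g U Q v x * (1 / k + G x) + 2 * U * v x * (A - U * Y x)) by lra.
    rewrite HXx. unfold dflux. field. lra.
Qed.

Theorem theorem2 : forall (g k Upsilon m Q alpha : R),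
  0 < g -> 0 < k -> 0 < alpha < 1 ->
  forall (w : R -> R) (h : R),
  critical_point g k Upsilon m Q alpha w h ->
  let v := fun x : R => w x + h in
  let v' := Derive v in
  (forall x : R,
     Cop (k * h) (fun y => (Q - 2 * g * v y - Upsilon ^ 2 * v y ^ 2) * v' y) x
     + (Q - 2 * g * v x - Upsilon ^ 2 * v x ^ 2) * (1 / k + Cop (k * h) v' x)
     - 2 * Upsilon * v x
       * (m / (k * h) - Upsilon / (2 * k * h) * mean (fun y => v y ^ 2)
          - Upsilon * Cop (k * h) (fun y => v y * v' y) x)
     - (Q - 2 * Upsilon * m - 2 * g * h) / k
     + 2 * g * mean (fun y => v y * Cop (k * h) v' y) = 0)
  /\
  mean (fun x =>
    (m / (k * h) - Upsilon / (2 * k * h) * mean (fun y => v y ^ 2)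
     - Upsilon * Cop (k * h) (fun y => v y * v' y) x
     + Upsilon * v x * (1 / k + Cop (k * h) v' x)) ^ 2)
  - mean (fun x =>
    (Q - 2 * g * v x) * (v' x ^ 2 + (1 / k + Cop (k * h) v' x) ^ 2)) = 0.
Proof.
  intros g k U m Q alpha _ Hk [Ha _] w h Hcrit v v'.
  destruct (Hcrit) as ((Hh & HC2 & Hm) & _).
  assert (Hw := periodic_C2_of_Hoelder alpha w Ha HC2).
  assert (Hv : periodic_C2 v) by (unfold v; auto with smooth).
  assert (He : forall x, euler g k U m Q h v x = mean (euler g k U m Q h v)).
  { apply euler_const; trivial. intros b n.
    apply (critical_variation g k U m Q alpha); auto using smooth_periodic_trig with smooth.
    rewrite mean_integral, integral_trig. ring. }
  split.
  - intro x.
    change (euler g k U m Q h v x - (Q - 2 * U * m - 2 * g * h) / k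
            + 2 * g * mean (fun y => v y * Cop (k * h) (Derive v) y) = 0).
    rewrite He, mean_integral, integral_euler; trivial.
    + field. split; [lra|apply PI_neq0].
    + rewrite mean_integral. unfold v.
      rewrite integral_plus, integral_const, integral_mean, Hm by auto with cont.
      field. apply PI_neq0.
  - apply Rminus_diag_eq.
    apply (critical_constraint g k U m Q h v); trivial.
    now apply (critical_height g k U m Q alpha).
Qed.
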